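(* The set of (Gödel numbers of) constructively true arithmetical sentences is $\Pi^1_1$-hard: every $\Pi^1_1$ set of natural numbers is many-one reducible, by a recursive function, to the set of constructively true arithmetical sentences.
   Context: Arithmetical formulas are first-order formulas in the symbols $0,1,+,\cdot,<,=$, connectives $\neg,\wedge,\vee,\rightarrow$ and quantifiers $\exists,\forall$ over the natural numbers. Witnesses (continuous function realizability, essentially Kleene's function realizability) are sets of natural numbers (reals), defined for formulas with free variables assigned natural numbers, by recursion: a witness for an atomic formula or for $\neg A$ exists iff the formula is true ($\neg A$ is true iff $A$ has no witness) and carries no information; a witness for $A\wedge B$ provides witnesses for $A$ and for $B$; a witness for $A\vee B$ chooses $A$ or $B$ and provides a witness for the chosen disjunct; a witness for $\exists x\,A(x)$ provides a number $n$ and a witness for $A(n)$; a witness for $\forall x\,A(x)$ provides, on input $n$, a witness for $A(n)$; a witness for $A\rightarrow B$ is a real $W$ coding a continuous map (each piece of output is determined by finite initial segments of the input) such that for every witness $X$ of $A$ (an arbitrary, not necessarily computable, set), $W_X$ is a witness for $B$. A sentence is constructively true iff it has a recursive (computable) witness; equivalently, it is realized by a recursive function in Kleene's function realizability. *)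

(* Defs.v *)
From Stdlib Require Import Arith List Cantor.
Import ListNotations.

(** * First-order formulas over the natural numbers *)

(** Variables are de Bruijn indices: [Var i] refers to the [i]-th enclosing
    quantifier, counted from the innermost one. *)
Inductive term : Type :=
| Var (i : nat)
| Zero
| One
| Add (t u : term)
| Mul (t u : term).

(** The type of atoms is a parameter, so that the same formulas serve for the
    language of arithmetic and for its extension by a set variable. *)
Inductive formula (atom : Type) : Type :=
| Atom (a : atom)
| Neg (A : formula atom)
| And (A B : formula atom)
| Or (A B : formula atom)
| Imp (A B : formula atom)
| Ex (A : formula atom)
| All (A : formula atom).

Arguments Atom {atom} a.
Arguments Neg {atom} A.
Arguments And {atom} A B.
Arguments Or {atom} A B.
Arguments Imp {atom} A B.
Arguments Ex {atom} A.
Arguments All {atom} A.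

Inductive arith_atom : Type :=
| Eq (t u : term)
| Lt (t u : term).

(** [Mem t] is [t ∈ X], for the only set variable [X]. *)
Inductive set_atom : Type :=
| FO (a : arith_atom)
| Mem (t : term).

(** [..._bounded k]: every free variable has index less than [k]. *)
Fixpoint term_bounded (k : nat) (t : term) : Prop :=
  match t with
  | Var i => i < k
  | Zero | One => True
  | Add t u | Mul t u => term_bounded k t /\ term_bounded k u
  end.

Definition arith_atom_bounded (k : nat) (a : arith_atom) : Prop :=
  match a with
  | Eq t u | Lt t u => term_bounded k t /\ term_bounded k u
  end.

Definition set_atom_bounded (k : nat) (a : set_atom) : Prop :=
  match a with
  | FO a => arith_atom_bounded k a
  | Mem t => term_bounded k t
  end.

Fixpoint bounded {atom : Type} (atom_bounded : nat -> atom -> Prop)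
    (k : nat) (A : formula atom) : Prop :=
  match A with
  | Atom a => atom_bounded k a
  | Neg A => bounded atom_bounded k A
  | And A B | Or A B | Imp A B =>
      bounded atom_bounded k A /\ bounded atom_bounded k B
  | Ex A | All A => bounded atom_bounded (S k) A
  end.

Definition sentence (A : formula arith_atom) : Prop :=
  bounded arith_atom_bounded 0 A.

Definition env : Type := nat -> nat.

Definition env0 : env := fun _ => 0.

Definition scons (n : nat) (e : env) : env :=
  fun i => match i with 0 => n | S j => e j end.

Fixpoint eval_term (e : env) (t : term) : nat :=
  match t with
  | Var i => e i
  | Zero => 0
  | One => 1
  | Add t u => eval_term e t + eval_term e u
  | Mul t u => eval_term e t * eval_term e u
  end.

Definition arith_atom_holds (e : env) (a : arith_atom) : Prop :=
  match a with
  | Eq t u => eval_term e t = eval_term e u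
  | Lt t u => eval_term e t < eval_term e u
  end.

Definition set_atom_holds (X : nat -> Prop) (e : env) (a : set_atom) : Prop :=
  match a with
  | FO a => arith_atom_holds e a
  | Mem t => X (eval_term e t)
  end.

(** Classical (Tarskian) satisfaction; used for the definition of Π¹₁ sets
    only. *)
Fixpoint sat {atom : Type} (holds : env -> atom -> Prop)
    (e : env) (A : formula atom) : Prop :=
  match A with
  | Atom a => holds e a
  | Neg A => ~ sat holds e A
  | And A B => sat holds e A /\ sat holds e B
  | Or A B => sat holds e A \/ sat holds e B
  | Imp A B => sat holds e A -> sat holds e B
  | Ex A => exists n, sat holds (scons n e) A
  | All A => forall n, sat holds (scons n e) A
  end.

(** [P] is [{n | ∀ X ⊆ ℕ, φ(n, X)}] with all quantifiers of φ over numbers. *)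
Definition Pi11 (P : nat -> Prop) : Prop :=
  exists phi : formula set_atom,
    bounded set_atom_bounded 1 phi /\
    forall n, P n <->
      forall X : nat -> Prop, sat (set_atom_holds X) (scons n env0) phi.

(** * Recursive functions *)

Inductive prog : Type :=
| PZero
| PSucc
| PProj (i : nat)
| PComp (f : prog) (gs : list prog)
| PRec (f g : prog)
| PMin (f : prog).

(** [eval p v y]: the partial recursive function [p] is defined at the
    arguments [v], with value [y]. *)
Inductive eval : prog -> list nat -> nat -> Prop :=
| eval_zero v : eval PZero v 0
| eval_succ x v : eval PSucc (x :: v) (S x)
| eval_proj i v y : nth_error v i = Some y -> eval (PProj i) v y
| eval_comp f gs v ys y :
    eval_list gs v ys -> eval f ys y -> eval (PComp f gs) v y
| eval_rec0 f g v y : eval f v y -> eval (PRec f g) (0 :: v) y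
| eval_recS f g n v r y :
    eval (PRec f g) (n :: v) r -> eval g (n :: r :: v) y ->
    eval (PRec f g) (S n :: v) y
| eval_min f v n (k : nat -> nat) :
    (forall m, m < n -> eval f (m :: v) (S (k m))) ->
    eval f (n :: v) 0 -> eval (PMin f) v n
with eval_list : list prog -> list nat -> list nat -> Prop :=
| eval_nil v : eval_list [] v []
| eval_cons g gs v y ys :
    eval g v y -> eval_list gs v ys -> eval_list (g :: gs) v (y :: ys).

Definition recursive (f : nat -> nat) : Prop :=
  exists p : prog, forall n, eval p [n] (f n).

Definition recursive_set (X : nat -> Prop) : Prop :=
  exists f : nat -> nat, recursive f /\
    forall n, (X n /\ f n = 1) \/ (~ X n /\ f n = 0).

Definition many_one_reducible (P Q : nat -> Prop) : Prop :=
  exists f : nat -> nat, recursive f /\ forall n, P n <-> Q (f n).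

(** * Witnesses *)

Definition pair (m n : nat) : nat := Cantor.to_nat (m, n).

Fixpoint code_string (s : list bool) : nat :=
  match s with
  | [] => 0
  | b :: s => S (2 * code_string s + Nat.b2n b)
  end.

Definition initial_segment (s : list bool) (X : nat -> Prop) : Prop :=
  forall i, i < length s -> (nth i s false = true <-> X i).

(** [⟨s, ⟨n, b⟩⟩ ∈ W] means: as soon as the input is seen to start with [s],
    bit [n] of the output is [b]. *)
Definition outputs (W X : nat -> Prop) (n : nat) (b : bool) : Prop :=
  exists s, initial_segment s X /\
    W (pair (code_string s) (pair n (Nat.b2n b))).

(** [W_X] is defined and equal to [Y]. *)
Definition applies (W X Y : nat -> Prop) : Prop :=
  forall n, (outputs W X n true <-> Y n) /\ (outputs W X n false <-> ~ Y n).

Definition even_part (X : nat -> Prop) : nat -> Prop := fun n => X (2 * n).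
Definition odd_part (X : nat -> Prop) : nat -> Prop := fun n => X (2 * n + 1).
Definition tail (X : nat -> Prop) : nat -> Prop := fun n => X (S n).
Definition column (X : nat -> Prop) (n : nat) : nat -> Prop :=
  fun m => X (pair n m).

(** Encoding of the data: a witness for a conjunction is the join of two
    witnesses; bit 0 of a witness for a disjunction makes the choice; a witness
    for [∃x A(x)] is the join of the singleton [{n}] and a witness for
    [A(n)]; a witness for [∀x A(x)] has a witness for [A(n)] as its column [n].
    For atomic and negated formulas, which carry no information, every set is
    a witness as soon as the formula is true. *)
Fixpoint witness (e : env) (A : formula arith_atom) (W : nat -> Prop) : Prop :=
  match A with
  | Atom a => arith_atom_holds e a
  | Neg A => ~ exists X, witness e A X
  | And A B => witness e A (even_part W) /\ witness e B (odd_part W)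
  | Or A B =>
      (W 0 /\ witness e A (tail W)) \/ (~ W 0 /\ witness e B (tail W))
  | Imp A B =>
      forall X, witness e A X -> exists Y, applies W X Y /\ witness e B Y
  | Ex A =>
      exists n, (forall m, even_part W m <-> m = n) /\
        witness (scons n e) A (odd_part W)
  | All A => forall n, witness (scons n e) A (column W n)
  end.

(** For sentences the assignment is irrelevant. *)
Definition constructively_true (A : formula arith_atom) : Prop :=
  exists W, recursive_set W /\ witness env0 A W.

(** * Gödel numbers *)

Fixpoint code_term (t : term) : nat :=
  match t with
  | Var i => pair 0 i
  | Zero => pair 1 0
  | One => pair 2 0
  | Add t u => pair 3 (pair (code_term t) (code_term u))
  | Mul t u => pair 4 (pair (code_term t) (code_term u))
  end.

Fixpoint code_formula (A : formula arith_atom) : nat :=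
  match A with
  | Atom (Eq t u) => pair 0 (pair (code_term t) (code_term u))
  | Atom (Lt t u) => pair 1 (pair (code_term t) (code_term u))
  | Neg A => pair 2 (code_formula A)
  | And A B => pair 3 (pair (code_formula A) (code_formula B))
  | Or A B => pair 4 (pair (code_formula A) (code_formula B))
  | Imp A B => pair 5 (pair (code_formula A) (code_formula B))
  | Ex A => pair 6 (code_formula A)
  | All A => pair 7 (code_formula A)
  end.

Definition constructive_truth_set (m : nat) : Prop :=
  exists A : formula arith_atom,
    code_formula A = m /\ sentence A /\ constructively_true A.

(* Main.v *)
From Stdlib Require Import Arith List Cantor Lia Classical ClassicalEpsilon.
From Stdlib Require Import FunctionalExtensionality PropExtensionality.
Require Import Defs.
Import ListNotations.

(** A formula has some witness iff it is classically true, so only the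
    recursiveness of the witness can carry the hardness. A Π¹₁ set is
    [{n | the tree T_n has no infinite branch}] for an arithmetical family of
    trees. Consider the sentence

      ∀x [ (∀s ∃y answer(x, s, y)) → secret(x) ∨ ¬ secret(x) ],

    where [answer] and [secret] are arithmetical and negated, hence carry no
    information. A witness of the premise is a function which sends a node to a
    child and reveals [secret(x)] at the leaves. If [T_n] is well-founded, one
    follows this function from the root until the secret is revealed. If not, a
    recursive witness, with program [x] say, has to make its choice on a
    function which follows an infinite branch, after reading finitely many
    values. The definition of [secret(x)] is a diagonalization: it searches for
    the first such finite run of program [x], takes the opposite of the choice
    made, and declares the other nodes read in this run invalid, so that the run
    extends to a witness of the premise. *)

(** * Existence of witnesses and classical truth *)

Lemma pair_inj a b c d : pair a b = pair c d -> a = c /\ b = d.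
Proof. unfold pair; intro E. apply Cantor.to_nat_inj in E. now injection E. Qed.

Notation sata := (sat arith_atom_holds).

(** The delicate case is implication: a true consequent has a witness, which a constant map outputs,
    and an antecedent without witnesses makes the condition vacuous. It follows that negation turns
    any arithmetical condition into a formula without information. *)
Lemma witness_exists_iff_sat (A : formula arith_atom) :
  forall e, (exists W, witness e A W) <-> sata e A.
Proof.
  induction A as [a|A IH|A IHA B IHB|A IHA B IHB|A IHA B IHB|A IH|A IH];
    intro e; simpl.
  - split; [intros [_ H]; exact H | intro H; exists (fun _ => True); exact H].
  - rewrite <- IH. split; [intros [_ H]; exact H | intro H; exists (fun _ => True); exact H].
  - rewrite <- IHA, <- IHB. split.
    + intros [W [HA HB]]. split; eauto.
    + intros [[X HX] [Y HY]].
      exists (fun n => if Nat.even n then X (n / 2) else Y (n / 2)). split.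
      * replace (even_part _) with X; [exact HX|].
        apply functional_extensionality; intro n. unfold even_part.
        rewrite Nat.even_even.
        now rewrite Nat.mul_comm, Nat.div_mul.
      * replace (odd_part _) with Y; [exact HY|].
        apply functional_extensionality; intro n. unfold odd_part.
        rewrite Nat.even_odd.
        now rewrite <- (Nat.div_unique (2 * n + 1) 2 n 1) by lia.
  - rewrite <- IHA, <- IHB. split.
    + intros [W [[_ H]|[_ H]]]; eauto.
    + intros [[X HX]|[X HX]].
      * exists (fun n => match n with 0 => True | S m => X m end). left. split; [exact I|exact HX].
      * exists (fun n => match n with 0 => False | S m => X m end). right. split; [intros []|exact HX].
  - rewrite <- IHA, <- IHB. split.
    + intros [W HW] [X HX]. destruct (HW X HX) as [Y [_ HY]]. eauto.
    + intro H. destruct (classic (exists X, witness e A X)) as [HA|HA].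
      * destruct (H HA) as [Y HY].
        (* Every input string, the empty one included, already determines all bits of [Y]. *)
        exists (fun z => exists t n b, z = pair t (pair n (Nat.b2n b)) /\ (b = true <-> Y n)).
        intros X _. exists Y. split; [|exact HY].
        assert (Hb : forall b b', Nat.b2n b = Nat.b2n b' -> b = b')
          by (intros [] [] ?; simpl in *; congruence).
        assert (Ho : forall n b,
          outputs (fun z => exists t n b, z = pair t (pair n (Nat.b2n b)) /\ (b = true <-> Y n)) X n b
          <-> (b = true <-> Y n)).
        { intros n b. split.
          - intros [s [_ (t & n' & b' & E & Hy)]].
            apply pair_inj in E as [_ E]. apply pair_inj in E as [E1 E2]. apply Hb in E2. now subst.
          - intro Hy. exists []. split; [intros i Hi; inversion Hi|]. now exists (code_string []), n, b. }
        intro n. split; rewrite Ho; intuition congruence.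
      * exists (fun _ => True). intros X HX. exfalso; eauto.
  - split.
    + intros [W [n [_ H]]]. exists n. apply IH. eauto.
    + intros [n H]. apply IH in H as [X HX].
      exists (fun m => if Nat.even m then m / 2 = n else X (m / 2)). exists n. split.
      * intro m. unfold even_part. rewrite Nat.even_even.
        now rewrite Nat.mul_comm, Nat.div_mul.
      * replace (odd_part _) with X; [exact HX|].
        apply functional_extensionality; intro m. unfold odd_part.
        rewrite Nat.even_odd.
        now rewrite <- (Nat.div_unique (2 * m + 1) 2 m 1) by lia.
  - split.
    + intros [W HW] n. apply IH. eauto.
    + intro H.
      assert (H' : forall n, exists X, witness (scons n e) A X) by (intro n; apply IH, H).
      destruct (choice _ H') as [X HX].
      exists (fun z => X (fst (Cantor.of_nat z)) (snd (Cantor.of_nat z))). intro n.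
      replace (column _ n) with (X n); [apply HX|].
      apply functional_extensionality; intro m. unfold column, pair.
      now rewrite Cantor.cancel_of_to.
Qed.

Lemma witness_Neg_iff (e : env) (A : formula arith_atom) (W : nat -> Prop) :
  witness e (Neg A) W <-> ~ sata e A.
Proof. simpl. now rewrite witness_exists_iff_sat. Qed.

(** * Arithmetical predicates *)

(* [None] stands for the term [Zero], so that a map can both rename variables
   and close a formula. *)
Definition lift_map (r : nat -> option nat) (i : nat) : option nat :=
  match i with 0 => Some 0 | S j => option_map S (r j) end.

Fixpoint map_term (r : nat -> option nat) (t : term) : term :=
  match t with
  | Var i => match r i with Some j => Var j | None => Zero end
  | Zero => Zero
  | One => One
  | Add t u => Add (map_term r t) (map_term r u)
  | Mul t u => Mul (map_term r t) (map_term r u)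
  end.

Fixpoint map_vars (r : nat -> option nat) (A : formula arith_atom) : formula arith_atom :=
  match A with
  | Atom (Eq t u) => Atom (Eq (map_term r t) (map_term r u))
  | Atom (Lt t u) => Atom (Lt (map_term r t) (map_term r u))
  | Neg A => Neg (map_vars r A)
  | And A B => And (map_vars r A) (map_vars r B)
  | Or A B => Or (map_vars r A) (map_vars r B)
  | Imp A B => Imp (map_vars r A) (map_vars r B)
  | Ex A => Ex (map_vars (lift_map r) A)
  | All A => All (map_vars (lift_map r) A)
  end.

Definition map_env (r : nat -> option nat) (e : env) : env :=
  fun i => match r i with Some j => e j | None => 0 end.

Lemma eval_map_term r e t : eval_term e (map_term r t) = eval_term (map_env r e) t.
Proof.
  induction t; simpl; auto. unfold map_env. now destruct (r i).
Qed.

Lemma map_env_lift r n e : map_env (lift_map r) (scons n e) = scons n (map_env r e).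
Proof.
  apply functional_extensionality; intros [|i]; [reflexivity|].
  unfold map_env; simpl. now destruct (r i).
Qed.

Lemma sat_map_vars A : forall r e, sata e (map_vars r A) <-> sata (map_env r e) A.
Proof.
  induction A as [[t u|t u]|A IH|A IHA B IHB|A IHA B IHB|A IHA B IHB|A IH|A IH];
    intros r e; simpl; rewrite ?eval_map_term; try tauto.
  - now rewrite IH.
  - now rewrite IHA, IHB.
  - now rewrite IHA, IHB.
  - now rewrite IHA, IHB.
  - split; intros [n H]; exists n; revert H; now rewrite IH, map_env_lift.
  - split; intros H n; specialize (H n); revert H; now rewrite IH, map_env_lift.
Qed.

Lemma map_term_bounded r k t :
  (forall i j, r i = Some j -> j < k) -> term_bounded k (map_term r t).
Proof.
  intro Hr. induction t; simpl; auto. destruct (r i) eqn:E; simpl; eauto.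
Qed.

Lemma map_vars_bounded A : forall r k,
  (forall i j, r i = Some j -> j < k) -> bounded arith_atom_bounded k (map_vars r A).
Proof.
  assert (Hl : forall r k, (forall i j, r i = Some j -> j < k) ->
    forall i j, lift_map r i = Some j -> j < S k).
  { intros r k Hr [|i] j; simpl.
    - intro E; injection E; lia.
    - destruct (r i) eqn:E; simpl; intro E'; inversion E'; subst. apply Hr in E; lia. }
  induction A as [[t u|t u]|A IH|A IHA B IHB|A IHA B IHB|A IHA B IHB|A IH|A IH];
    intros r k Hr; simpl; auto using map_term_bounded.
  - apply IH. now apply Hl.
  - apply IH. now apply Hl.
Qed.

(** Definability is taken semantically, so that the long formulas needed below are never written
    out: closure properties produce them. *)
Definition Def (P : env -> Prop) : Prop :=
  exists A : formula arith_atom, forall e, sata e A <-> P e.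

Definition DefF (f : env -> nat) : Prop :=
  Def (fun e => e 0 = f (fun i => e (S i))).

Lemma Def_iff P Q : (forall e, P e <-> Q e) -> Def P -> Def Q.
Proof. intros H [A HA]. exists A. intro e. now rewrite HA. Qed.

Lemma Def_not P : Def P -> Def (fun e => ~ P e).
Proof. intros [A HA]. exists (Neg A). intro e; simpl. now rewrite HA. Qed.
Lemma Def_and P Q : Def P -> Def Q -> Def (fun e => P e /\ Q e).
Proof. intros [A HA] [B HB]. exists (And A B). intro e; simpl. now rewrite HA, HB. Qed.
Lemma Def_or P Q : Def P -> Def Q -> Def (fun e => P e \/ Q e).
Proof. intros [A HA] [B HB]. exists (Or A B). intro e; simpl. now rewrite HA, HB. Qed.
Lemma Def_imp P Q : Def P -> Def Q -> Def (fun e => P e -> Q e).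
Proof. intros [A HA] [B HB]. exists (Imp A B). intro e; simpl. now rewrite HA, HB. Qed.
Lemma Def_equiv P Q : Def P -> Def Q -> Def (fun e => P e <-> Q e).
Proof. intros HP HQ. apply Def_and; now apply Def_imp. Qed.

Lemma Def_ex (P : env -> nat -> Prop) :
  Def (fun e => P (fun i => e (S i)) (e 0)) -> Def (fun e => exists n, P e n).
Proof.
  intros [A HA]. exists (Ex A). intro e; simpl.
  split; intros [n H]; exists n;
    [exact (proj1 (HA (scons n e)) H)|exact (proj2 (HA (scons n e)) H)].
Qed.
Lemma Def_all (P : env -> nat -> Prop) :
  Def (fun e => P (fun i => e (S i)) (e 0)) -> Def (fun e => forall n, P e n).
Proof.
  intros [A HA]. exists (All A). intro e; simpl.
  split; intros H n;
    [exact (proj1 (HA (scons n e)) (H n))|exact (proj2 (HA (scons n e)) (H n))].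
Qed.

Lemma Def_rename (r : nat -> nat) P : Def P -> Def (fun e => P (fun i => e (r i))).
Proof.
  intros [A HA]. exists (map_vars (fun i => Some (r i)) A). intro e.
  rewrite sat_map_vars, HA. reflexivity.
Qed.

Lemma DefF_rename (r : nat -> nat) f : DefF f -> DefF (fun e => f (fun i => e (r i))).
Proof.
  intro Hf. exact (Def_rename (fun i => match i with 0 => 0 | S j => S (r j) end) _ Hf).
Qed.

Lemma DefF_var i : DefF (fun e => e i).
Proof. exists (Atom (Eq (Var 0) (Var (S i)))). reflexivity. Qed.
Lemma DefF_0 : DefF (fun _ => 0).
Proof. exists (Atom (Eq (Var 0) Zero)). reflexivity. Qed.

(** The language has no symbol for [f], so its value is named by an existential quantifier and fixed
    by the graph of [f]. *)
Lemma Def_app_aux P f : Def P -> DefF f -> Def (fun e => P (scons (f e) e)).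
Proof.
  intros HP Hf.
  apply (Def_iff (fun e => exists y, y = f e /\ P (scons y e))).
  - intro e. split; [intros (y & -> & H); exact H|eauto].
  - apply Def_ex, Def_and; [exact Hf|].
    apply (Def_iff P); [|exact HP]. intro e.
    replace (scons (e 0) _) with e; [reflexivity|].
    apply functional_extensionality; now intros [|i].
Qed.

Lemma Def_eqF f g : DefF f -> DefF g -> Def (fun e => f e = g e).
Proof.
  intros Hf Hg. exact (Def_app_aux _ f Hg Hf).
Qed.

Lemma Def_eq_aux (h : nat -> nat -> nat) t f g :
  (forall e, eval_term e t = h (e 1) (e 0)) ->
  DefF f -> DefF g -> DefF (fun e => h (f e) (g e)).
Proof.
  intros Ht Hf Hg.
  assert (H : Def (fun e => e 2 = h (e 1) (e 0))).
  { exists (Atom (Eq (Var 2) t)). intro e. simpl. now rewrite Ht. }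
  apply (DefF_rename S) in Hf.
  apply (DefF_rename S) in Hg. apply (DefF_rename S) in Hg.
  pose proof (Def_app_aux _ _ (Def_app_aux _ _ H Hg) Hf) as H1. exact H1.
Qed.

Lemma DefF_add f g : DefF f -> DefF g -> DefF (fun e => f e + g e).
Proof. apply (Def_eq_aux Nat.add (Add (Var 1) (Var 0))). reflexivity. Qed.
Lemma DefF_mul f g : DefF f -> DefF g -> DefF (fun e => f e * g e).
Proof. apply (Def_eq_aux Nat.mul (Mul (Var 1) (Var 0))). reflexivity. Qed.
Lemma DefF_S f : DefF f -> DefF (fun e => S (f e)).
Proof.
  intro Hf. apply (Def_eq_aux (fun x _ => S x) (Add (Var 1) One) f f); auto.
  intro e; simpl; lia.
Qed.

Lemma Def_lt f g : DefF f -> DefF g -> Def (fun e => f e < g e).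
Proof.
  intros Hf Hg. apply (DefF_rename S) in Hf.
  refine (Def_app_aux _ _ (Def_app_aux (fun e => e 0 < e 1) _ _ Hf) Hg).
  exists (Atom (Lt (Var 0) (Var 1))). reflexivity.
Qed.
Lemma Def_le f g : DefF f -> DefF g -> Def (fun e => f e <= g e).
Proof.
  intros Hf Hg. apply (Def_iff (fun e => f e < S (g e))); [intro; lia|].
  apply Def_lt; auto using DefF_S.
Qed.

Lemma DefF_subst_term t (s : env -> env) :
  (forall i, DefF (fun e => s e i)) -> DefF (fun e => eval_term (s e) t).
Proof.
  intro Hs. induction t; simpl.
  - apply Hs.
  - apply DefF_0.
  - apply (DefF_S (fun _ => 0)), DefF_0.
  - now apply DefF_add.
  - now apply DefF_mul.
Qed.

(** All variables are replaced at once, which no iteration of [Def_app_aux] achieves. Induction on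
    the formula pushes [s] down to the terms, lifting it under each quantifier. *)
Lemma Def_subst P (s : env -> env) :
  Def P -> (forall i, DefF (fun e => s e i)) -> Def (fun e => P (s e)).
Proof.
  intros [A HA] Hs.
  apply (Def_iff (fun e => sata (s e) A)); [intro; apply HA|]. clear P HA. revert s Hs.
  assert (Hup : forall s : env -> env, (forall i, DefF (fun e => s e i)) ->
    forall i, DefF (fun e => scons (e 0) (s (fun j => e (S j))) i)).
  { intros s Hs [|i]; simpl; [apply DefF_var|exact (DefF_rename S _ (Hs i))]. }
  induction A as [[t u|t u]|A IH|A IHA B IHB|A IHA B IHB|A IHA B IHB|A IH|A IH];
    intros s Hs; simpl.
  - apply Def_eqF; now apply DefF_subst_term.
  - apply Def_lt; now apply DefF_subst_term.
  - apply Def_not; auto.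
  - apply Def_and; auto.
  - apply Def_or; auto.
  - apply Def_imp; auto.
  - apply Def_ex. apply (IH (fun e => scons (e 0) (s (fun j => e (S j))))). auto.
  - apply Def_all. apply (IH (fun e => scons (e 0) (s (fun j => e (S j))))). auto.
Qed.

Lemma DefF_scons (f : env -> nat) (s : env -> env) :
  DefF f -> (forall i, DefF (fun e => s e i)) ->
  forall i, DefF (fun e => scons (f e) (s e) i).
Proof. intros Hf Hs [|i]; simpl; auto. Qed.

Lemma Def_app1 R f : Def (fun e => R (e 0)) -> DefF f -> Def (fun e => R (f e)).
Proof.
  intros HR Hf. apply (Def_subst _ (fun e => scons (f e) e) HR).
  auto using DefF_scons, DefF_var.
Qed.
Lemma Def_app2 R f g : Def (fun e => R (e 0) (e 1)) ->
  DefF f -> DefF g -> Def (fun e => R (f e) (g e)).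
Proof.
  intros HR Hf Hg. apply (Def_subst _ (fun e => scons (f e) (scons (g e) e)) HR).
  auto 10 using DefF_scons, DefF_var.
Qed.
Lemma Def_app3 R f g h : Def (fun e => R (e 0) (e 1) (e 2)) ->
  DefF f -> DefF g -> DefF h -> Def (fun e => R (f e) (g e) (h e)).
Proof.
  intros HR Hf Hg Hh.
  apply (Def_subst _ (fun e => scons (f e) (scons (g e) (scons (h e) e))) HR).
  auto 10 using DefF_scons, DefF_var.
Qed.
Lemma DefF_app1 F f : DefF (fun e => F (e 0)) -> DefF f -> DefF (fun e => F (f e)).
Proof.
  intros HF Hf. apply (DefF_rename S) in Hf.
  refine (Def_subst _ (fun e => scons (e 0) (scons (f (fun i => e (S i))) e)) HF _).
  auto 10 using DefF_scons, DefF_var.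
Qed.
Lemma DefF_app2 F f g : DefF (fun e => F (e 0) (e 1)) ->
  DefF f -> DefF g -> DefF (fun e => F (f e) (g e)).
Proof.
  intros HF Hf Hg. apply (DefF_rename S) in Hf. apply (DefF_rename S) in Hg.
  refine (Def_subst _ (fun e => scons (e 0) (scons (f (fun i => e (S i)))
    (scons (g (fun i => e (S i))) e))) HF _).
  auto 10 using DefF_scons, DefF_var.
Qed.

Create HintDb def.
#[local] Hint Resolve DefF_var DefF_0 DefF_S DefF_add DefF_mul : def.
#[local] Hint Resolve Def_eqF Def_lt Def_le : def.

Ltac def :=
  repeat (cbv beta;
    first [ solve [auto 40 with def nocore]
          | apply Def_not | apply Def_equiv | apply Def_and | apply Def_or
          | apply Def_ex | apply Def_all | apply Def_imp ]).

(** * The Cantor pairing is arithmetical *)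

Lemma pair_spec x y : 2 * pair x y = (x + y) * S (x + y) + 2 * y.
Proof. unfold pair. pose proof (Cantor.to_nat_spec x y). nia. Qed.

Lemma pair_ge x y : x <= pair x y /\ y <= pair x y.
Proof. pose proof (pair_spec x y). nia. Qed.

Definition pi1 (z : nat) : nat := fst (Cantor.of_nat z).
Definition pi2 (z : nat) : nat := snd (Cantor.of_nat z).

Lemma pi1_pair x y : pi1 (pair x y) = x.
Proof. unfold pi1, pair. now rewrite Cantor.cancel_of_to. Qed.
Lemma pi2_pair x y : pi2 (pair x y) = y.
Proof. unfold pi2, pair. now rewrite Cantor.cancel_of_to. Qed.
Lemma pair_pi z : pair (pi1 z) (pi2 z) = z.
Proof.
  unfold pi1, pi2, pair. rewrite <- surjective_pairing. apply Cantor.cancel_to_of.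
Qed.

Lemma DefF_pair f g : DefF f -> DefF g -> DefF (fun e => pair (f e) (g e)).
Proof.
  apply (DefF_app2 pair). unfold DefF.
  (* Doubling the equation avoids the division by two in the triangular number. *)
  apply (Def_iff (fun e => e 0 + e 0 = (e 1 + e 2) * S (e 1 + e 2) + (e 2 + e 2))).
  - intro e. pose proof (pair_spec (e 1) (e 2)). lia.
  - def.
Qed.
#[local] Hint Resolve DefF_pair : def.

Lemma DefF_pi1 f : DefF f -> DefF (fun e => pi1 (f e)).
Proof.
  apply (DefF_app1 pi1). unfold DefF.
  apply (Def_iff (fun e => exists w, e 1 = pair (e 0) w)).
  - intro e. split.
    + intros [w ->]. now rewrite pi1_pair.
    + intros ->. exists (pi2 (e 1)). now rewrite pair_pi.
  - def.
Qed.
Lemma DefF_pi2 f : DefF f -> DefF (fun e => pi2 (f e)).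
Proof.
  apply (DefF_app1 pi2). unfold DefF.
  apply (Def_iff (fun e => exists w, e 1 = pair w (e 0))).
  - intro e. split.
    + intros [w ->]. now rewrite pi2_pair.
    + intros ->. exists (pi1 (e 1)). now rewrite pair_pi.
  - def.
Qed.
#[local] Hint Resolve DefF_pi1 DefF_pi2 : def.

(** * Finite sets coded by numbers *)

(* A variant of Gödel's beta function: the moduli [1 + (j + 1) * B!] with
   [j < B] are pairwise coprime, so a finite set is coded by the product of
   the moduli of its elements. *)
Definition Mem (c j : nat) : Prop :=
  exists B u w q, c = pair B (pair u w) /\ j < B /\ u = q * S (S j * w).

Lemma Def_Mem f g : DefF f -> DefF g -> Def (fun e => Mem (f e) (g e)).
Proof. apply (Def_app2 Mem). unfold Mem. def. Qed.
#[local] Hint Resolve Def_Mem : def.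

Lemma divide_fact B d : 0 < d <= B -> Nat.divide d (fact B).
Proof.
  induction B as [|B IH]; intro H; [lia|].
  change (fact (S B)) with (S B * fact B).
  destruct (Nat.eq_dec d (S B)) as [->|Hd].
  - apply Nat.divide_factor_l.
  - apply Nat.divide_mul_r, IH. lia.
Qed.

(** With [w] for [B!], a common divisor divides [(j+1)(1+(i+1)w) - (i+1)(1+(j+1)w) = j - i]. This
    difference is below [B], so the divisor also divides [w], hence 1. *)
Lemma moduli_coprime B i j : i < j < B ->
  Nat.gcd (S (S i * fact B)) (S (S j * fact B)) = 1.
Proof.
  intro H. set (w := fact B). set (g := Nat.gcd _ _).
  assert (Hi : Nat.divide g (S (S i * w))) by apply Nat.gcd_divide_l.
  assert (Hj : Nat.divide g (S (S j * w))) by apply Nat.gcd_divide_r.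
  assert (Hd : Nat.divide g (j - i)).
  { replace (j - i) with (S j * S (S i * w) - S i * S (S j * w)) by nia.
    apply Nat.divide_sub_r; now apply Nat.divide_mul_r. }
  assert (Hw : Nat.divide g w)
    by (apply Nat.divide_trans with (j - i); [exact Hd|apply divide_fact; lia]).
  apply Nat.divide_1_r. apply (Nat.divide_add_cancel_r g (S i * w)).
  - now apply Nat.divide_mul_r.
  - now rewrite Nat.add_1_r.
Qed.

(** The product is built one element at a time: a modulus coprime to the new factor divides the new
    product only if it divided the old one. Since [E] is decided classically, the code exists
    without being computed. *)
Lemma finite_set_coded (E : nat -> Prop) (B : nat) :
  exists c, forall j, Mem c j <-> j < B /\ E j.
Proof.
  set (m := fun j => S (S j * fact B)).
  assert (Hm : forall j, 2 <= m j) by (intro j; pose proof (lt_O_fact B); unfold m; nia).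
  assert (H : forall k, k <= B -> exists u, forall j, j < B ->
    (Nat.divide (m j) u <-> j < k /\ E j)).
  { induction k as [|k IH]; intro Hk.
    - exists 1. intros j _. split; [|lia]. intro D. apply Nat.divide_1_r in D.
      specialize (Hm j). lia.
    - destruct IH as [u Hu]; [lia|].
      destruct (classic (E k)) as [Ek|Ek].
      + exists (m k * u). intros j Hj. destruct (Nat.eq_dec j k) as [->|Hjk].
        * split; [intro; split; [lia|exact Ek]|intros _; apply Nat.divide_factor_l].
        * assert (L : j < S k <-> j < k) by lia. rewrite L, <- Hu by exact Hj. clear L.
          split; [|apply Nat.divide_mul_r].
          intro D. apply Nat.gauss with (1 := D).
          destruct (Nat.lt_total j k) as [L|[L|L]]; [|lia|].
          -- apply moduli_coprime; lia.
          -- rewrite Nat.gcd_comm. apply moduli_coprime; lia.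
      + exists u. intros j Hj. rewrite Hu by exact Hj.
        split; intros [L Ej]; (split; [|exact Ej]); [lia|].
        destruct (Nat.eq_dec j k) as [->|]; [contradiction|lia]. }
  destruct (H B (le_n B)) as [u Hu].
  exists (pair B (pair u (fact B))). intro j. split.
  - intros (B' & u' & w & q & E1 & Hj & Hq).
    apply pair_inj in E1 as [<- E1]. apply pair_inj in E1 as [<- <-].
    split; [exact Hj|]. apply Hu; [exact Hj|]. now exists q.
  - intros [Hj Ej]. destruct (proj2 (Hu j Hj) (conj Hj Ej)) as [q Hq].
    now exists B, u, (fact B), q.
Qed.

(** * A universal arithmetical predicate for recursive functions *)

Fixpoint code_list (v : list nat) : nat :=
  match v with [] => 0 | x :: v => S (pair x (code_list v)) end.

(** The inner fixpoint is a copy of [code_progs], as the recursion is nested. Lists of programs get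
    tags of their own, 6 and 7, so that claims about [eval] and [eval_list] can live in one set. *)
Fixpoint code_prog (p : prog) : nat :=
  match p with
  | PZero => pair 0 0
  | PSucc => pair 1 0
  | PProj i => pair 2 i
  | PComp f gs =>
      pair 3 (pair (code_prog f)
        ((fix code_progs (gs : list prog) : nat :=
           match gs with
           | [] => pair 6 0
           | g :: gs => pair 7 (pair (code_prog g) (code_progs gs))
           end) gs))
  | PRec f g => pair 4 (pair (code_prog f) (code_prog g))
  | PMin f => pair 5 (code_prog f)
  end.

Fixpoint code_progs (gs : list prog) : nat :=
  match gs with
  | [] => pair 6 0
  | g :: gs => pair 7 (pair (code_prog g) (code_progs gs))
  end.

Lemma code_prog_comp f gs :
  code_prog (PComp f gs) = pair 3 (pair (code_prog f) (code_progs gs)).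
Proof. reflexivity. Qed.

(* [D p v y] stands for a set of claims "[eval p v y]" and "[eval_list p v y]",
   and [justified D p v y] says that the claim [(p, v, y)] is the conclusion of
   a rule whose premises are in [D]. *)
Definition justified (D : nat -> nat -> nat -> Prop) (p v y : nat) : Prop :=
  (p = pair 0 0 /\ y = 0) \/
  (p = pair 1 0 /\ exists x v', v = S (pair x v') /\ y = S x) \/
  (p = pair 2 0 /\ exists x v', v = S (pair x v') /\ y = x) \/
  (exists i x v', p = pair 2 (S i) /\ v = S (pair x v') /\ D (pair 2 i) v' y) \/
  (exists f gs ys, p = pair 3 (pair f gs) /\ D gs v ys /\ D f ys y) \/
  (exists f g v', p = pair 4 (pair f g) /\ v = S (pair 0 v') /\ D f v' y) \/
  (exists f g n v' r, p = pair 4 (pair f g) /\ v = S (pair (S n) v') /\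
     D p (S (pair n v')) r /\ D g (S (pair n (S (pair r v')))) y) \/
  (exists f, p = pair 5 f /\
     (forall m, m < y -> exists k, D f (S (pair m v)) (S k)) /\ D f (S (pair y v)) 0) \/
  (p = pair 6 0 /\ y = 0) \/
  (exists g gs a b, p = pair 7 (pair g gs) /\ y = S (pair a b) /\ D g v a /\ D gs v b).

Definition claims (c p v y : nat) : Prop := Mem c (pair p (pair v y)).

(** A derivation of [eval] is replaced by a finite set of claims that justifies itself; being coded
    by a single number, it makes the relation arithmetical. *)
Definition computes (p v y : nat) : Prop :=
  exists c, (forall p v y, claims c p v y -> justified (claims c) p v y) /\ claims c p v y.

Lemma Def_computes f g h : DefF f -> DefF g -> DefF h ->
  Def (fun e => computes (f e) (g e) (h e)).
Proof. apply (Def_app3 computes). unfold computes, justified, claims. def. Qed.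
#[local] Hint Resolve Def_computes : def.

Lemma justified_mono (D D' : nat -> nat -> nat -> Prop) p v y :
  (forall p v y, D p v y -> D' p v y) -> justified D p v y -> justified D' p v y.
Proof.
  intros H J. unfold justified in *.
  destruct J as [J|[J|[J|[J|[J|[J|[J|[J|[J|J]]]]]]]]].
  - tauto.
  - tauto.
  - tauto.
  - do 3 right. left. destruct J as (i & x & v' & ? & ? & ?). exists i, x, v'. auto.
  - do 4 right. left. destruct J as (f & gs & ys & ? & ? & ?). exists f, gs, ys. auto.
  - do 5 right. left. destruct J as (f & g & v' & ? & ? & ?). exists f, g, v'. auto.
  - do 6 right. left. destruct J as (f & g & n & v' & r & ? & ? & ? & ?).
    exists f, g, n, v', r. auto.
  - do 7 right. left. destruct J as (f & ? & Hm & ?). exists f. split; [auto|]. split; [|auto].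
    intros m L. destruct (Hm m L) as [k ?]. eauto.
  - tauto.
  - do 9 right. destruct J as (g & gs & a & b & ? & ? & ? & ?). exists g, gs, a, b. auto.
Qed.

Definition closed_finite (D : nat -> nat -> nat -> Prop) : Prop :=
  (exists B, forall p v y, D p v y -> pair p (pair v y) < B) /\
  (forall p v y, D p v y -> justified D p v y).

Lemma closed_finite_computes D p v y : closed_finite D -> D p v y -> computes p v y.
Proof.
  intros [[B HB] HD] Hy.
  destruct (finite_set_coded (fun z => D (pi1 z) (pi1 (pi2 z)) (pi2 (pi2 z))) B) as [c Hc].
  assert (E : forall p v y, claims c p v y <-> D p v y).
  { intros p' v' y'. unfold claims. rewrite Hc, !pi2_pair, !pi1_pair. firstorder. }
  exists c. split; [|now apply E].
  intros p' v' y' H. apply (justified_mono D); [firstorder|]. now apply HD, E.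
Qed.

Lemma closed_finite_union D D' : closed_finite D -> closed_finite D' ->
  closed_finite (fun p v y => D p v y \/ D' p v y).
Proof.
  intros [[B HB] HD] [[B' HB'] HD']. split.
  - exists (B + B'). intros p v y [H|H]; [apply HB in H|apply HB' in H]; lia.
  - intros p v y [H|H]; [apply HD in H|apply HD' in H];
      (eapply justified_mono; [|exact H]; auto).
Qed.

Lemma closed_finite_add D p v y : closed_finite D -> justified D p v y ->
  exists D', closed_finite D' /\ (forall p v y, D p v y -> D' p v y) /\ D' p v y.
Proof.
  intros [[B HB] HD] J.
  exists (fun p' v' y' => D p' v' y' \/ (p' = p /\ v' = v /\ y' = y)).
  split; [split|split; auto].
  - exists (B + S (pair p (pair v y))).
    intros p' v' y' [H|(-> & -> & ->)]; [apply HB in H|]; lia.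
  - intros p' v' y' [H|(-> & -> & ->)]; [apply HD in H|];
      (eapply justified_mono; [|eassumption]; auto).
Qed.

(** Minimization has a premise for each [m] below its value, each supported by its own finite set;
    all of them are needed in one set. *)
Lemma closed_finite_family (Q : nat -> (nat -> nat -> nat -> Prop) -> Prop) n :
  (forall m D D', (forall p v y, D p v y -> D' p v y) -> Q m D -> Q m D') ->
  (forall m, m < n -> exists D, closed_finite D /\ Q m D) ->
  exists D, closed_finite D /\ forall m, m < n -> Q m D.
Proof.
  intros HQ. induction n as [|n IH]; intro H.
  - exists (fun _ _ _ => False). split; [|lia]. split; [exists 0|]; tauto.
  - destruct IH as (D & HD & HD'); [intros; apply H; lia|].
    destruct (H n) as (E & HE & HE'); [lia|].
    exists (fun p v y => D p v y \/ E p v y). split; [now apply closed_finite_union|].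
    intros m L. destruct (Nat.eq_dec m n) as [->|].
    + apply (HQ n E); auto.
    + apply (HQ m D); [auto|]. apply HD'. lia.
Qed.

Scheme eval_mut := Minimality for eval Sort Prop
  with eval_list_mut := Minimality for eval_list Sort Prop.

Definition derivable (p v y : nat) : Prop := exists D, closed_finite D /\ D p v y.

Lemma derivable_0 p v y : justified (fun _ _ _ => False) p v y -> derivable p v y.
Proof.
  intro J. destruct (closed_finite_add (fun _ _ _ => False) p v y) as (D & H1 & _ & H2).
  - split; [exists 0|]; tauto.
  - exact J.
  - now exists D.
Qed.

Lemma derivable_1 a b c p v y : derivable a b c ->
  (forall D : nat -> nat -> nat -> Prop, D a b c -> justified D p v y) -> derivable p v y.
Proof.
  intros (D & H1 & H2) J. destruct (closed_finite_add D p v y H1) as (D' & H3 & _ & H4); auto.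
  now exists D'.
Qed.

Lemma derivable_2 a b c a' b' c' p v y : derivable a b c -> derivable a' b' c' ->
  (forall D : nat -> nat -> nat -> Prop, D a b c -> D a' b' c' -> justified D p v y) ->
  derivable p v y.
Proof.
  intros (D & H1 & H2) (D' & H1' & H2') J.
  destruct (closed_finite_add _ p v y (closed_finite_union D D' H1 H1')) as (E & H3 & _ & H4).
  - apply J; auto.
  - now exists E.
Qed.

Lemma eval_derivable p v y :
  eval p v y -> derivable (code_prog p) (code_list v) y.
Proof.
  apply (eval_mut (fun p v y => derivable (code_prog p) (code_list v) y)
    (fun gs v ys => derivable (code_progs gs) (code_list v) (code_list ys))); clear p v y.
  - intro v. apply derivable_0. left. auto.
  - intros x v. apply derivable_0. right. left. split; [reflexivity|]. exists x, (code_list v). auto.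
  (* [justified] contains no list lookup: a projection walks down its argument list, with one claim
     for each index. *)
  - induction i as [|i IH]; intros [|x v] y E; try discriminate; simpl in E.
    + injection E as ->. apply derivable_0. do 2 right. left. split; [reflexivity|].
      exists y, (code_list v). auto.
    + apply IH in E. apply (derivable_1 _ _ _ _ _ _ E). intros D HD.
      do 3 right. left. exists i, x, (code_list v). auto.
  - intros f gs v ys y _ H1 _ H2. apply (derivable_2 _ _ _ _ _ _ _ _ _ H1 H2).
    intros D D1 D2. do 4 right. left. rewrite code_prog_comp.
    exists (code_prog f), (code_progs gs), (code_list ys). auto.
  - intros f g v y _ H. apply (derivable_1 _ _ _ _ _ _ H). intros D HD.
    do 5 right. left. exists (code_prog f), (code_prog g), (code_list v). auto.
  - intros f g n v r y _ H1 _ H2. apply (derivable_2 _ _ _ _ _ _ _ _ _ H1 H2).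
    intros D D1 D2. do 6 right. left.
    exists (code_prog f), (code_prog g), n, (code_list v), r. auto.
  - intros f v n k _ Hm _ (D & HD & HD0).
    destruct (closed_finite_family
      (fun m D => D (code_prog f) (S (pair m (code_list v))) (S (k m))) n) as (E & HE & HE').
    + auto.
    + exact Hm.
    + destruct (closed_finite_add _ (code_prog (PMin f)) (code_list v) n
        (closed_finite_union D E HD HE)) as (D' & H1 & _ & H2); [|now exists D'].
      do 7 right. left. exists (code_prog f). split; [reflexivity|]. split; [|auto].
      intros m L. exists (k m). auto.
  - intro v. apply derivable_0. do 8 right. left. auto.
  - intros g gs v y ys _ H1 _ H2. apply (derivable_2 _ _ _ _ _ _ _ _ _ H1 H2).
    intros D D1 D2. do 9 right.
    exists (code_prog g), (code_progs gs), y, (code_list ys). auto.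
Qed.

Lemma eval_computes p v y : eval p v y -> computes (code_prog p) (code_list v) y.
Proof.
  intro H. apply eval_derivable in H as (D & H1 & H2). now apply (closed_finite_computes D).
Qed.

Ltac invert_codes :=
  repeat match goal with
  | H : _ \/ _ |- _ => destruct H as [H|H]
  | H : _ /\ _ |- _ => destruct H
  | H : exists _, _ |- _ => destruct H
  | H : pair _ _ = pair _ _ |- _ => apply pair_inj in H as [? ?]
  | H : S _ = S _ |- _ => injection H as H
  | H : 0 = S _ |- _ => discriminate H
  | H : S _ = 0 |- _ => discriminate H
  end.

(* No order on the claims is needed: a claim about an evaluation that does
   terminate is settled by induction on that evaluation. *)
Lemma justified_eval (D : nat -> nat -> nat -> Prop) p v y :
  (forall p v y, D p v y -> justified D p v y) ->
  eval p v y -> forall y', D (code_prog p) (code_list v) y' -> y' = y.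
Proof.
  intro HD. revert p v y.
  apply (eval_mut (fun p v y => forall y', D (code_prog p) (code_list v) y' -> y' = y)
    (fun gs v ys => forall y', D (code_progs gs) (code_list v) y' -> y' = code_list ys)).
  - intros v y' H. apply HD in H. unfold justified in H. cbn [code_prog] in H.
    invert_codes; subst; congruence.
  - intros x v y' H. apply HD in H. unfold justified in H. cbn [code_prog code_list] in H.
    invert_codes; subst; congruence.
  - induction i as [|i IH]; intros [|x v] y E; try discriminate; simpl in E;
      intros y' H; apply HD in H; unfold justified in H; cbn [code_prog code_list] in H;
      invert_codes; subst; try discriminate.
    + congruence.
    + now apply (IH v).
  - intros f gs v ys y _ H1 _ H2 y' H. apply HD in H. unfold justified in H.
    rewrite code_prog_comp in H. invert_codes; try discriminate. subst.
    match goal with K : D (code_progs gs) _ _ |- _ => apply H1 in K; subst end. auto.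
  - intros f g v y _ H1 y' H. apply HD in H. unfold justified in H.
    cbn [code_prog code_list] in H. invert_codes; try discriminate; subst; auto.
  - intros f g n v r y _ H1 _ H2 y' H. apply HD in H. unfold justified in H.
    cbn [code_prog code_list] in H. invert_codes; try discriminate; subst.
    match goal with K : D (pair 4 _) _ _ |- _ => apply H1 in K; subst end. auto.
  - intros f v n k _ Hm _ H0 y' H. apply HD in H. unfold justified in H.
    cbn [code_prog] in H. invert_codes; try discriminate; subst.
    match goal with K : forall m, m < y' -> _, K0 : D _ _ 0 |- _ =>
      rename K into Hlt; rename K0 into Hy' end.
    (* A smaller claimed minimum would be a zero of [f] below [n], and a larger one would require a
       nonzero value at [n]. *)
    destruct (Nat.lt_total y' n) as [L|[L|L]]; [|exact L|].
    + apply (Hm y' L) in Hy'. discriminate.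
    + destruct (Hlt n L) as [j Hj]. apply (H0 (S j)) in Hj. discriminate.
  - intros v y' H. apply HD in H. unfold justified in H. cbn [code_progs] in H.
    invert_codes; subst; try discriminate; reflexivity.
  - intros g gs v y ys _ H1 _ H2 y' H. apply HD in H. unfold justified in H.
    cbn [code_progs] in H. invert_codes; try discriminate; subst.
    match goal with K : D (code_prog g) _ _ |- _ => apply H1 in K; subst end.
    match goal with K : D (code_progs gs) _ _ |- _ => apply H2 in K; subst end.
    reflexivity.
Qed.

Lemma computes_eval p v y y' :
  eval p v y -> computes (code_prog p) (code_list v) y' -> y' = y.
Proof. intros H (c & Hc & Hy'). eapply (justified_eval (claims c)); eauto. Qed.

(** [S (pair m 0)] is the code of the argument list [[m]]. As the characteristic function is total,
    a claimed value always agrees with the true one, so 1 cannot be claimed outside [X]. *)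
Lemma recursive_set_computes (X : nat -> Prop) :
  recursive_set X -> exists x, forall m, X m <-> computes x (S (pair m 0)) 1.
Proof.
  intros (f & [p Hp] & Hf). exists (code_prog p). intro m.
  change (S (pair m 0)) with (code_list [m]).
  destruct (Hf m) as [[Hm E]|[Hm E]]; specialize (Hp m); rewrite E in Hp.
  - split; [intros _; now apply eval_computes|auto].
  - split; [tauto|]. intro H. apply (computes_eval _ _ _ _ Hp) in H. discriminate.
Qed.

Lemma finite_function_coded (f : nat -> nat) (k : nat) :
  exists c, forall i u, Mem c (pair i u) <-> i < k /\ u = f i.
Proof.
  assert (HB : exists B, forall i, i < k -> pair i (f i) < B).
  { induction k as [|k [B IH]]; [exists 0; lia|].
    exists (B + S (pair k (f k))). intros i Hi.
    destruct (Nat.eq_dec i k) as [->|]; [lia|]. specialize (IH i). lia. }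
  destruct HB as [B HB].
  destruct (finite_set_coded (fun z => pi1 z < k /\ pi2 z = f (pi1 z)) B) as [c Hc].
  exists c. intros i u. rewrite Hc, pi1_pair, pi2_pair. split; [tauto|].
  intros [Hi ->]. auto.
Qed.

(** * A tree normal form for Π¹₁ sets *)

(* Every requirement looks at two values of the Skolem function [h] and at one
   value of the set parameter [g]. *)
Definition skolem_form (Q : (nat -> nat) -> env -> Prop) : Prop :=
  exists R : nat -> nat -> nat -> nat -> nat -> nat -> env -> Prop,
    Def (fun e => R (e 0) (e 1) (e 2) (e 3) (e 4) (e 5)
                    (fun i => e (S (S (S (S (S (S i)))))))) /\
    forall g e, Q g e <-> exists h, forall i j a, R i (h i) j (h j) a (g a) e.

Lemma Def_app7 R f1 f2 f3 f4 f5 f6 (s : env -> env) :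
  Def (fun e => R (e 0) (e 1) (e 2) (e 3) (e 4) (e 5)
                  (fun i => e (S (S (S (S (S (S i)))))))) ->
  DefF f1 -> DefF f2 -> DefF f3 -> DefF f4 -> DefF f5 -> DefF f6 ->
  (forall i, DefF (fun e => s e i)) ->
  Def (fun e => R (f1 e) (f2 e) (f3 e) (f4 e) (f5 e) (f6 e) (s e)).
Proof.
  intros HR H1 H2 H3 H4 H5 H6 Hs.
  apply (Def_subst _ (fun e => scons (f1 e) (scons (f2 e) (scons (f3 e)
    (scons (f4 e) (scons (f5 e) (scons (f6 e) (s e))))))) HR).
  repeat apply DefF_scons; auto.
Qed.

Lemma skolem_form_iff Q Q' :
  (forall g e, Q g e <-> Q' g e) -> skolem_form Q -> skolem_form Q'.
Proof.
  intros H (R & HR & HQ). exists R. split; [exact HR|]. intros g e. now rewrite <- H.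
Qed.

Lemma skolem_form_const P : Def P -> skolem_form (fun _ e => P e).
Proof.
  intro HP. exists (fun _ _ _ _ _ _ e => P e). split.
  - exact (Def_rename (fun i => S (S (S (S (S (S i)))))) P HP).
  - intros g e. split; [intro H; now exists (fun _ => 0)|intros [h H]; exact (H 0 0 0)].
Qed.

Lemma skolem_form_app t (P : nat -> Prop) :
  Def (fun e => P (e 0)) -> skolem_form (fun g e => P (g (eval_term e t))).
Proof.
  intro HP. exists (fun _ _ _ _ a b e => a = eval_term e t -> P b). split.
  - apply Def_imp; [apply Def_eqF; [apply DefF_var|]|].
    + apply (DefF_subst_term t (fun e i => e (S (S (S (S (S (S i)))))))).
      intro i. apply DefF_var.
    + apply (Def_app1 P); [exact HP|apply DefF_var].
  - intros g e. split.
    + intro H. exists (fun _ => 0). now intros _ _ a ->.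
    + intros [h H]. now apply (H 0 0).
Qed.

Lemma skolem_form_and Q Q' : skolem_form Q -> skolem_form Q' ->
  skolem_form (fun g e => Q g e /\ Q' g e).
Proof.
  intros (R & HR & HQ) (R' & HR' & HQ').
  exists (fun i u j v a b e =>
    R i (pi1 u) j (pi1 v) a b e /\ R' i (pi2 u) j (pi2 v) a b e). split.
  - apply Def_and; apply Def_app7; auto with def.
  - intros g e. rewrite HQ, HQ'. split.
    + intros [[h Hh] [h' Hh']]. exists (fun i => pair (h i) (h' i)).
      intros i j a. rewrite !pi1_pair, !pi2_pair. auto.
    + intros [h Hh]. split; [exists (fun i => pi1 (h i))|exists (fun i => pi2 (h i))];
        intros i j a; apply Hh.
Qed.

(** Each value of the new Skolem function carries the chosen disjunct in its first component.
    Comparing two values forces the choice to be constant, which is why requirements see [h] at two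
    places. *)
Lemma skolem_form_or Q Q' : skolem_form Q -> skolem_form Q' ->
  skolem_form (fun g e => Q g e \/ Q' g e).
Proof.
  intros (R & HR & HQ) (R' & HR' & HQ').
  exists (fun i u j v a b e => pi1 u = pi1 v /\
    ((pi1 u = 0 /\ R i (pi2 u) j (pi2 v) a b e) \/
     (pi1 u <> 0 /\ R' i (pi2 u) j (pi2 v) a b e))). split.
  - def; apply Def_app7; auto with def.
  - intros g e. rewrite HQ, HQ'. split.
    + intros [[h Hh]|[h Hh]];
        [exists (fun i => pair 0 (h i))|exists (fun i => pair 1 (h i))];
        intros i j a; rewrite !pi1_pair, !pi2_pair; auto.
    + intros [h Hh]. destruct (Nat.eq_dec (pi1 (h 0)) 0) as [E|E]; [left|right];
        exists (fun i => pi2 (h i)); intros i j a;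
        destruct (Hh 0 i 0) as [E0 _]; destruct (Hh i j a) as [_ H];
        rewrite E0 in E; tauto.
Qed.

(** As for disjunction, the number [n] is stored in every value and forced to be constant. *)
Lemma skolem_form_ex Q : skolem_form Q -> skolem_form (fun g e => exists n, Q g (scons n e)).
Proof.
  intros (R & HR & HQ).
  exists (fun i u j v a b e =>
    pi1 u = pi1 v /\ R i (pi2 u) j (pi2 v) a b (scons (pi1 u) e)). split.
  - apply Def_and; [auto with def|].
    apply Def_app7; auto with def. apply DefF_scons; auto with def.
  - intros g e. split.
    + intros [n Hn]. apply HQ in Hn as [h Hh]. exists (fun i => pair n (h i)).
      intros i j a. rewrite !pi1_pair, !pi2_pair. auto.
    + intros [h Hh]. exists (pi1 (h 0)). apply HQ. exists (fun i => pi2 (h i)).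
      intros i j a. destruct (Hh 0 i 0) as [-> _]. apply Hh.
Qed.

(** The Skolem functions for the various [n] are merged into one on pairs [⟨n, i⟩]; requirements
    apply only to positions with the same [n]. *)
Lemma skolem_form_all Q : skolem_form Q -> skolem_form (fun g e => forall n, Q g (scons n e)).
Proof.
  intros (R & HR & HQ).
  exists (fun p u q v a b e =>
    pi1 p = pi1 q -> R (pi2 p) u (pi2 q) v a b (scons (pi1 p) e)). split.
  - apply Def_imp; [auto with def|].
    apply Def_app7; auto with def. apply DefF_scons; auto with def.
  - intros g e. split.
    + intro H.
      assert (H' : forall n, exists h, forall i j a, R i (h i) j (h j) a (g a) (scons n e))
        by (intro n; apply HQ, H).
      destruct (choice _ H') as [h Hh]. exists (fun p => h (pi1 p) (pi2 p)).
      intros p q a <-. apply Hh.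
    + intros [h Hh] n. apply HQ. exists (fun i => h (pair n i)). intros i j a.
      specialize (Hh (pair n i) (pair n j) a). rewrite !pi1_pair, !pi2_pair in Hh. auto.
Qed.

Notation sats g := (sat (set_atom_holds (fun i => g i = 1))).

(** Treating a formula together with its negation replaces a passage to negation normal form. *)
Lemma sat_skolem_form A :
  skolem_form (fun g e => sats g e A) /\ skolem_form (fun g e => ~ sats g e A).
Proof.
  induction A as [[a|t]|A [IH IH']|A [IHA IHA'] B [IHB IHB']|A [IHA IHA'] B [IHB IHB']
                 |A [IHA IHA'] B [IHB IHB']|A [IH IH']|A [IH IH']]; simpl.
  - split; [|apply (skolem_form_const (fun e => ~ arith_atom_holds e a)), Def_not];
      [apply (skolem_form_const (fun e => arith_atom_holds e a))|]; now exists (Atom a).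
  - split; [apply (skolem_form_app t (fun b => b = 1))|apply (skolem_form_app t (fun b => b <> 1))];
      def.
  - split; [exact IH'|]. apply (skolem_form_iff _ _ (fun g e => conj (fun H H' => H' H) (NNPP _)) IH).
  - split; [now apply skolem_form_and|].
    apply (skolem_form_iff (fun g e => ~ sats g e A \/ ~ sats g e B)).
    + intros g e. tauto.
    + now apply skolem_form_or.
  - split; [now apply skolem_form_or|].
    apply (skolem_form_iff (fun g e => ~ sats g e A /\ ~ sats g e B)).
    + intros g e. tauto.
    + now apply skolem_form_and.
  - split.
    + apply (skolem_form_iff (fun g e => ~ sats g e A \/ sats g e B)).
      * intros g e. tauto.
      * now apply skolem_form_or.
    + apply (skolem_form_iff (fun g e => sats g e A /\ ~ sats g e B)).
      * intros g e. tauto.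
      * now apply skolem_form_and.
  - split; [now apply (skolem_form_ex (fun g e => sats g e A))|].
    apply (skolem_form_iff (fun g e => forall n, ~ sats g (scons n e) A)).
    + intros g e. firstorder.
    + now apply (skolem_form_all (fun g e => ~ sats g e A)).
  - split; [now apply (skolem_form_all (fun g e => sats g e A))|].
    apply (skolem_form_iff (fun g e => exists n, ~ sats g (scons n e) A)).
    + intros g e. split; [firstorder|apply not_all_ex_not].
    + now apply (skolem_form_ex (fun g e => ~ sats g e A)).
Qed.

Definition infinite_chain (T : nat -> nat -> Prop) : Prop :=
  exists s : nat -> nat, s 0 = 0 /\ forall k, T (s k) (s (S k)).

(* The nodes are pairs of a length [k] and a code of a function on [{i | i < k}]. *)
Definition extends (R : nat -> nat -> nat -> nat -> nat -> nat -> Prop) (s s' : nat) : Prop :=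
  pi1 s' = S (pi1 s) /\
  (forall i u, i < pi1 s -> Mem (pi2 s) (pair i u) -> Mem (pi2 s') (pair i u)) /\
  (forall i, i < pi1 s' -> exists u, forall u', Mem (pi2 s') (pair i u') <-> u' = u) /\
  (forall i j a u v b, i < pi1 s' -> j < pi1 s' -> a < pi1 s' ->
    Mem (pi2 s') (pair i u) -> Mem (pi2 s') (pair j v) -> Mem (pi2 s') (pair a b) ->
    R i u j v a b).

(** A chain is a growing sequence of finite functions whose union is [H]; conversely, the
    restrictions of [H] form a chain. *)
Lemma extends_chain_iff R :
  infinite_chain (extends R) <-> exists H, forall i j a, R i (H i) j (H j) a (H a).
Proof.
  split.
  - intros (s & s0 & Hs).
    assert (Hlen : forall k, pi1 (s k) = k).
    { induction k as [|k IH]; [now rewrite s0|].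
      destruct (Hs k) as [E _]. now rewrite E, IH. }
    assert (Hfun : forall i k, i < k -> exists u, forall u', Mem (pi2 (s k)) (pair i u') <-> u' = u).
    { intros i [|k] Hi; [lia|]. destruct (Hs k) as (_ & _ & Hf & _).
      apply Hf. now rewrite Hlen. }
    destruct (choice _ (fun i => Hfun i (S i) (Nat.lt_succ_diag_r i))) as [H HH].
    assert (Hstable : forall i k, i < k -> Mem (pi2 (s k)) (pair i (H i))).
    { intros i. induction k as [|k IH]; intro Hi; [lia|].
      destruct (Nat.eq_dec i k) as [->|]; [now apply HH|].
      destruct (Hs k) as (_ & He & _). apply He; [rewrite Hlen; lia|]. apply IH; lia. }
    (* The node after stage [i + j + a] has length [i + j + a + 1], so all three positions are in
       its domain. *)
    exists H. intros i j a. destruct (Hs (i + j + a)) as (_ & _ & _ & HR).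
    rewrite Hlen in HR. apply HR; (lia || apply Hstable; lia).
  - intros [H HH].
    destruct (choice _ (finite_function_coded H)) as [c Hc].
    (* Chains must start at the number 0, which is a node of length 0. *)
    exists (fun k => match k with 0 => 0 | S _ => pair k (c k) end). split; [reflexivity|].
    intro k. unfold extends. rewrite pi1_pair, pi2_pair.
    replace (pi1 _) with k by (destruct k; [reflexivity|now rewrite pi1_pair]).
    split; [reflexivity|]. split; [|split].
    + intros i u Hi. destruct k as [|k]; [lia|]. rewrite pi2_pair, !Hc. intros [_ ->]. split; lia.
    + intros i Hi. exists (H i). intro u'. rewrite Hc. tauto.
    + intros i j a u v b _ _ _. rewrite !Hc. intros [_ ->] [_ ->] [_ ->]. apply HH.
Qed.

(** A chain is a counterexample [X] together with Skolem functions for the negated matrix: each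
    value is a pair of a Skolem value and a value of [g], where [X] is the set of [i] with
    [g i = 1]. *)
Lemma Pi11_no_infinite_chain P : Pi11 P -> exists T : nat -> nat -> nat -> Prop,
  Def (fun e => T (e 0) (e 1) (e 2)) /\ forall n, P n <-> ~ infinite_chain (T n).
Proof.
  intros (A & _ & HA). destruct (sat_skolem_form A) as [_ (R & HR & HQ)].
  set (R' := fun n i u j v a b => R i (pi1 u) j (pi1 v) a (pi2 b) (scons n env0)).
  exists (fun n => extends (R' n)). split.
  - unfold extends, R'. def. apply Def_app7; auto 10 with def.
    apply DefF_scons; [auto with def|]. intro i. apply DefF_0.
  - intro n. rewrite extends_chain_iff, HA. split.
    + intros H [f Hf]. refine (proj2 (HQ (fun a => pi2 (f a)) (scons n env0)) _ (H _)).
      exists (fun i => pi1 (f i)). exact Hf.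
    + intros H X. apply NNPP. intro HX. apply H.
      set (g := fun i => if excluded_middle_informative (X i) then 1 else 0).
      assert (EX : X = (fun i => g i = 1)).
      { apply functional_extensionality. intro i. apply propositional_extensionality.
        unfold g. destruct (excluded_middle_informative (X i)); split; easy. }
      rewrite EX in HX. apply HQ in HX as [h Hh].
      exists (fun i => pair (h i) (g i)). intros i j a. unfold R'.
      rewrite !pi1_pair, pi2_pair. apply Hh.
Qed.

(** * The diagonal construction *)

(* The witness of [∀s ∃y ...] given by the function [f] is
   [{⟨s, 2 f(s)⟩ | s ∈ ℕ}]; [graph_bit d] is this set for the function coded
   by [d]. *)
Definition graph_bit (d i : nat) : Prop :=
  exists s y, i = pair s (y + y) /\ Mem d (pair s y).

(* [c] codes the map sending [i] to the code of bits [i], ..., [N - 1]. *)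
Definition segment_code (N d t : nat) : Prop :=
  exists c,
    (forall i u, Mem c (pair i u) ->
      (i = N /\ u = 0) \/
      (i < N /\ exists u', Mem c (pair (S i) u') /\
        ((graph_bit d i /\ u = S (S (u' + u'))) \/ (~ graph_bit d i /\ u = S (u' + u'))))) /\
    Mem c (pair 0 t).

Lemma Def_segment_code f g h : DefF f -> DefF g -> DefF h ->
  Def (fun e => segment_code (f e) (g e) (h e)).
Proof. apply (Def_app3 segment_code). unfold segment_code, graph_bit. def. Qed.
#[local] Hint Resolve Def_segment_code : def.

Lemma segment_code_iff N d t :
  segment_code N d t <->
  exists s, length s = N /\ code_string s = t /\ initial_segment s (graph_bit d).
Proof.
  split.
  - intros (c & Hc & Ht).
    assert (H : forall k i u, i + k = N -> Mem c (pair i u) ->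
      exists s, length s = k /\ code_string s = u /\
        forall j, j < k -> (nth j s false = true <-> graph_bit d (i + j))).
    { induction k as [|k IH]; intros i u Hi Hu.
      - destruct (Hc i u Hu) as [[_ ->]|[L _]]; [|lia].
        exists []. split; [reflexivity|]. split; [reflexivity|lia].
      - destruct (Hc i u Hu) as [[L _]|(_ & u' & Hu' & Hb)]; [lia|].
        apply IH in Hu' as (s & Hl & Hs & Hbits); [|lia].
        assert (Hb' : exists b : bool, (b = true <-> graph_bit d i) /\
                        u = S (2 * u' + Nat.b2n b)).
        { destruct Hb as [[Hb ->]|[Hb ->]]; [exists true|exists false];
            (split; [intuition congruence|simpl; lia]). }
        destruct Hb' as (b & Hb1 & Hb2).
        exists (b :: s). split; [simpl; lia|]. split; [simpl; now rewrite Hs|].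
        intros [|j] Hj; simpl.
        + now rewrite Nat.add_0_r.
        + rewrite Hbits by lia. now rewrite Nat.add_succ_r. }
    destruct (H N 0 t eq_refl Ht) as (s & Hl & Hs & Hb).
    exists s. split; [exact Hl|]. split; [exact Hs|]. unfold initial_segment. now rewrite Hl.
  - intros (s & Hl & Hs & Hb).
    (* The code records all suffixes of [s], from the whole string at 0 to the empty one at [N],
       hence [S N] entries. *)
    destruct (finite_function_coded (fun i => code_string (skipn i s)) (S N)) as [c Hc].
    exists c. split.
    + intros i u. rewrite Hc. intros [Hi ->].
      destruct (Nat.eq_dec i N) as [->|Hi'].
      * left. rewrite <- Hl, skipn_all. auto.
      * right. split; [lia|]. exists (code_string (skipn (S i) s)).
        rewrite Hc. split; [split; [lia|reflexivity]|].
        assert (Hn : skipn i s = nth i s false :: skipn (S i) s).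
        { clear Hb Hs Hc. revert i Hi Hi' Hl. revert N.
          induction s as [|b s IH]; intros N i Hi Hi' Hl; simpl in Hl; [lia|].
          destruct i as [|i]; [reflexivity|].
          apply (IH (pred N)); lia. }
        rewrite Hn. specialize (Hb i ltac:(lia)).
        destruct (nth i s false); [left|right]; simpl; (split; [intuition congruence|lia]).
    + apply Hc. split; [lia|]. now rewrite <- Hs.
Qed.

(** A position [pair s m] is at least [s], so a string of length [N] reveals nothing about nodes
    from [N] on; only the nodes below [N] have to be restricted. *)
Definition allowed (N c s : nat) : Prop := N <= s \/ Mem c s.

(* A finite piece of a run of the recursive set number [x] as a witness of the
   implication: on the input string coded by [t], which is the initial segment
   of length [N] of the witness given by the function coded by [d], it makes
   the choice [b]. On the allowed nodes below [N], [d] follows the tree [T]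
   inside the allowed nodes, so that [t] gives no hint for the choice. *)
Definition config (T : nat -> nat -> Prop) (x N c b d t : nat) : Prop :=
  b < 2 /\
  computes x (S (pair (pair x (pair t (pair 0 b))) 0)) 1 /\
  segment_code N d t /\
  allowed N c 0 /\
  (forall s, s < N -> exists y, forall y', Mem d (pair s y') <-> y' = y) /\
  (forall s, s < N -> allowed N c s ->
    exists s', Mem d (pair s (S (S s'))) /\ T s s' /\ allowed N c s').

Definition config_code (T : nat -> nat -> Prop) (x a : nat) : Prop :=
  config T x (pi1 a) (pi1 (pi2 a)) (pi1 (pi2 (pi2 a)))
    (pi1 (pi2 (pi2 (pi2 a)))) (pi2 (pi2 (pi2 (pi2 a)))).

Definition selected (T : nat -> nat -> Prop) (x a : nat) : Prop :=
  config_code T x a /\ forall a', a' < a -> ~ config_code T x a'.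

(** If no configuration exists, every node is valid and the tree is left unchanged. *)
Definition valid (T : nat -> nat -> Prop) (x s : nat) : Prop :=
  forall a, selected T x a -> allowed (pi1 a) (pi1 (pi2 a)) s.

(* The opposite of the choice made by the selected configuration. *)
Definition secret (T : nat -> nat -> Prop) (x : nat) : Prop :=
  exists a, selected T x a /\ pi1 (pi2 (pi2 a)) = 0.

(** Children are shifted by two because 0 and 1 reveal the secret. Invalid nodes accept any value,
    so that whatever a selected run has read there is harmless. *)
Definition answer (T : nat -> nat -> Prop) (x s y : nat) : Prop :=
  valid T x s ->
  (exists s', y = S (S s') /\ T s s' /\ valid T x s') \/
  ((forall s', T s s' -> ~ valid T x s') /\
   ((y = 0 /\ secret T x) \/ (y = 1 /\ ~ secret T x))).

Lemma Def_secret_answer (T : nat -> nat -> nat -> Prop) :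
  Def (fun e => T (e 0) (e 1) (e 2)) ->
  Def (fun e => secret (T (e 0)) (e 1)) /\
  Def (fun e => answer (T (e 0)) (e 1) (e 2) (e 3)).
Proof.
  intro HT.
  assert (HT' : forall f g h, DefF f -> DefF g -> DefF h ->
    Def (fun e => T (f e) (g e) (h e))) by (intros f g h; now apply Def_app3).
  assert (Hsel : forall f g h, DefF f -> DefF g -> DefF h ->
    Def (fun e => selected (T (f e)) (g e) (h e))).
  { intros f g h. apply (Def_app3 (fun n => selected (T n))).
    unfold selected, config_code, config, allowed. def. }
  assert (Hval : forall f g h, DefF f -> DefF g -> DefF h ->
    Def (fun e => valid (T (f e)) (g e) (h e))).
  { intros f g h. apply (Def_app3 (fun n => valid (T n))). unfold valid, allowed. def. }
  assert (Hsec : forall f g, DefF f -> DefF g -> Def (fun e => secret (T (f e)) (g e))).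
  { intros f g. apply (Def_app2 (fun n => secret (T n))). unfold secret. def. }
  split; [def|]. unfold answer. def.
Qed.

Lemma answer_total T x s : exists y, answer T x s y.
Proof.
  destruct (classic (exists s', T s s' /\ valid T x s')) as [[s' H]|H].
  - exists (S (S s')). intros _. left. eauto.
  - assert (H' : forall s', T s s' -> ~ valid T x s') by eauto.
    destruct (classic (secret T x)) as [Hs|Hs]; [exists 0|exists 1]; intros _; right; auto.
Qed.

(** This is what a witness of the premise amounts to. The odd positions of a column belong to a
    negated formula and are unconstrained. *)
Definition answers (T : nat -> nat -> Prop) (x : nat) (F : nat -> Prop) : Prop :=
  forall s, exists y, (forall m, F (pair s (2 * m)) <-> m = y) /\ answer T x s y.

Definition graph_set (f : nat -> nat) (i : nat) : Prop :=
  exists s, i = pair s (f s + f s).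

Lemma graph_set_answers T x f : (forall s, answer T x s (f s)) -> answers T x (graph_set f).
Proof.
  intros Hf s. exists (f s). split; [|apply Hf]. intro m. split.
  - intros [s' E]. apply pair_inj in E as [<- E]. lia.
  - intros ->. exists s. f_equal. lia.
Qed.

Lemma graph_set_bit f d N :
  (forall s y, s < N -> (Mem d (pair s y) <-> y = f s)) ->
  forall i, i < N -> (graph_bit d i <-> graph_set f i).
Proof.
  intros H i Hi. split.
  - intros (s & y & -> & Hy). pose proof (pair_ge s (y + y)).
    apply H in Hy as ->; [now exists s|lia].
  - intros [s ->]. pose proof (pair_ge s (f s + f s)).
    exists s, (f s). split; [reflexivity|]. apply H; [lia|reflexivity].
Qed.

Lemma initial_segment_ext s X Y :
  (forall i, i < length s -> (X i <-> Y i)) -> initial_segment s X -> initial_segment s Y.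
Proof. intros H Hs i Hi. rewrite <- H by exact Hi. now apply Hs. Qed.

Lemma exists_least (P : nat -> Prop) :
  (exists n, P n) -> exists n, P n /\ forall m, m < n -> ~ P m.
Proof.
  intros [n Hn]. induction n as [n IH] using lt_wf_ind.
  destruct (classic (exists m, m < n /\ P m)) as [(m & L & Hm)|H]; [eauto|].
  exists n. split; [exact Hn|]. intros m L Hm. eauto.
Qed.

(** If there were no configuration, all nodes would be valid. Let [f] stay on infinite chains
    wherever one starts and answer correctly elsewhere. The choice on [f] is made after a finite
    string; this string, with the nodes below its length that start infinite chains, is a
    configuration. *)
Lemma infinite_chain_config T W x :
  infinite_chain T ->
  (forall m, W m <-> computes x (S (pair m 0)) 1) ->
  (forall F, answers T x F ->
    exists Y, applies (column W x) F Y /\ (Y 0 <-> secret T x)) ->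
  exists a, config_code T x a.
Proof.
  intros (g & g0 & Hg) HW HF. apply NNPP. intro Hno.
  set (Inf := fun s => exists g : nat -> nat, g 0 = s /\ forall k, T (g k) (g (S k))).
  assert (HInf : forall s, Inf s -> exists s', T s s' /\ Inf s').
  { intros s (h & <- & Hh). exists (h 1). split; [apply Hh|].
    exists (fun k => h (S k)). auto. }
  assert (Hval : forall s, valid T x s) by (intros s a [Ha _]; exfalso; eauto).
  assert (Hf : forall s, exists y, answer T x s y /\
    (Inf s -> exists s', y = S (S s') /\ T s s' /\ Inf s')).
  { intro s. destruct (classic (Inf s)) as [Hs|Hs].
    - destruct (HInf s Hs) as (s' & H1 & H2). exists (S (S s')). split; [|eauto].
      intros _. left. eauto.
    - destruct (answer_total T x s) as [y Hy]. exists y. split; [exact Hy|contradiction]. }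
  destruct (choice _ Hf) as [f Hf']. clear Hf.
  destruct (HF (graph_set f)) as (Y & HY & HY0).
  { apply graph_set_answers. apply Hf'. }
  assert (Hout : exists b, outputs (column W x) (graph_set f) 0 b).
  { destruct (classic (Y 0)) as [H0|H0]; [exists true|exists false]; now apply HY. }
  destruct Hout as (b & t & Ht & Hb).
  destruct (finite_set_coded Inf (length t)) as [c Hc].
  destruct (finite_function_coded f (length t)) as [d Hd].
  assert (Hall : forall s, Inf s -> allowed (length t) c s).
  { intros s Hs. destruct (Nat.le_gt_cases (length t) s); [now left|right]. now apply Hc. }
  apply Hno. exists (pair (length t) (pair c (pair (Nat.b2n b) (pair d (code_string t))))).
  unfold config_code. rewrite !pi2_pair, !pi1_pair. repeat split.
  - destruct b; simpl; lia.
  - apply HW. exact Hb.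
  - apply segment_code_iff. exists t. split; [reflexivity|]. split; [reflexivity|].
    apply (initial_segment_ext _ (graph_set f)); [|exact Ht].
    intros i Hi. symmetry. apply (graph_set_bit f d (length t)); [|exact Hi].
    intros s y Hs. rewrite Hd. tauto.
  - apply Hall. exists g. auto.
  - intros s Hs. exists (f s). intro y'. rewrite Hd. tauto.
  - intros s Hs [Ha|Ha]; [lia|]. apply Hc in Ha as [_ Ha].
    destruct (proj2 (Hf' s) Ha) as (s' & E & H1 & H2).
    exists s'. rewrite Hd. auto.
Qed.

(** The index [x] of [W] is also the instance at which [W] is tested. The function in the least
    configuration, continued by arbitrary correct answers from [N] on, is a legitimate input; on it
    [W] makes the choice [b], and the secret is the opposite. *)
Lemma infinite_chain_not_decided T W :
  infinite_chain T -> recursive_set W ->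
  ~ forall x F, answers T x F ->
      exists Y, applies (column W x) F Y /\ (Y 0 <-> secret T x).
Proof.
  intros HT HW HF. apply recursive_set_computes in HW as [x Hx].
  destruct (exists_least _ (infinite_chain_config T W x HT Hx (HF x))) as (a & Ha & Hmin).
  assert (Hsel : forall a', selected T x a' <-> a' = a).
  { intro a'. split; [|intros ->; now split]. intros [H1 H2].
    destruct (Nat.lt_total a a') as [L|[L|L]]; [exfalso; now apply (H2 a)| |exfalso; now apply (Hmin a')].
    now symmetry. }
  assert (Hsec : secret T x <-> pi1 (pi2 (pi2 a)) = 0).
  { split; [intros (a' & H & E); now apply Hsel in H as ->|]. exists a. split; [now apply Hsel|auto]. }
  assert (Hval : forall s, valid T x s <-> allowed (pi1 a) (pi1 (pi2 a)) s).
  { intro s. split; [intro H; now apply H, Hsel|]. intros H a' Ha'. now apply Hsel in Ha' as ->. }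
  destruct Ha as (Hb & Hc & Hseg & _ & Hfun & Hstep).
  set (N := pi1 a) in *. set (c := pi1 (pi2 a)) in *. set (b := pi1 (pi2 (pi2 a))) in *.
  set (d := pi1 (pi2 (pi2 (pi2 a)))) in *. set (t := pi2 (pi2 (pi2 (pi2 a)))) in *.
  (* Below [N] the value from [d] is an answer: at an allowed node it names an allowed child, and at
     any other node validity fails. *)
  assert (Hf : forall s, exists y, answer T x s y /\
    (s < N -> forall y', Mem d (pair s y') <-> y' = y)).
  { intro s. destruct (Nat.lt_ge_cases s N) as [L|L].
    - destruct (Hfun s L) as [y Hy]. exists y. split; [|auto].
      intro Hs. destruct (Hstep s L (proj1 (Hval s) Hs)) as (s' & H1 & H2 & H3). left. exists s'.
      apply Hy in H1 as <-. rewrite Hval. auto.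
    - destruct (answer_total T x s) as [y Hy]. exists y. split; [exact Hy|lia]. }
  destruct (choice _ Hf) as [f Hf']. clear Hf.
  destruct (HF x (graph_set f)) as (Y & HY & HY0).
  { apply graph_set_answers. apply Hf'. }
  apply segment_code_iff in Hseg as (s & Hl & Hs & Hini).
  apply (initial_segment_ext _ _ (graph_set f)) in Hini.
  2: { apply graph_set_bit. intros s' y L. apply Hf'. lia. }
  assert (Hout : forall b', b = Nat.b2n b' -> outputs (column W x) (graph_set f) 0 b').
  { intros b' E. exists s. split; [exact Hini|]. apply Hx. now rewrite <- E, Hs. }
  assert (Eb : b = 0 \/ b = 1) by lia. destruct Eb as [Eb|Eb].
  - apply (proj1 (proj2 (HY 0)) (Hout false Eb)). now apply HY0, Hsec.
  - pose proof (proj1 (proj1 (HY 0)) (Hout true Eb)) as H.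
    apply HY0, Hsec in H. congruence.
Qed.

(** * Computable functions *)

Definition Comp (k : nat) (f : env -> nat) : Prop :=
  exists p, forall e, eval p (map e (seq 0 k)) (f e).

Lemma Comp_ext k f g : (forall e, f e = g e) -> Comp k f -> Comp k g.
Proof. intros H [p Hp]. exists p. intro e. now rewrite <- H. Qed.

Lemma Comp_var k i : i < k -> Comp k (fun e => e i).
Proof.
  intro H. exists (PProj i). intro e. constructor.
  rewrite nth_error_map, nth_error_seq. destruct (Nat.ltb_spec i k); [reflexivity|lia].
Qed.

Lemma Comp_subst m k f (s : env -> env) :
  Comp m f -> (forall i, i < m -> Comp k (fun e => s e i)) -> Comp k (fun e => f (s e)).
Proof.
  intros [p Hp] Hs.
  assert (H : exists gs, forall e, eval_list gs (map e (seq 0 k)) (map (s e) (seq 0 m))).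
  { clear p Hp f. assert (H : forall j, (forall i, i < j + m -> Comp k (fun e => s e i)) ->
      exists gs, forall e, eval_list gs (map e (seq 0 k)) (map (s e) (seq j m))).
    { clear Hs. induction m as [|m IH]; intros j Hj.
      - exists []. intro e. constructor.
      - destruct (IH (S j)) as [gs Hgs]; [intros i Hi; apply Hj; lia|].
        destruct (Hj j) as [g Hg]; [lia|]. exists (g :: gs). intro e. simpl.
        constructor; auto. }
    apply H. exact Hs. }
  destruct H as [gs Hgs]. exists (PComp p gs). intro e. econstructor; [apply Hgs|apply Hp].
Qed.

Lemma Comp_0 k : Comp k (fun _ => 0).
Proof. exists PZero. intro e. constructor. Qed.

Lemma Comp_app1 F k f : Comp 1 (fun e => F (e 0)) -> Comp k f -> Comp k (fun e => F (f e)).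
Proof.
  intros HF Hf. apply (Comp_subst 1 k _ (fun e => scons (f e) e) HF).
  intros [|i] Hi; [exact Hf|lia].
Qed.

Lemma Comp_app2 F k f g : Comp 2 (fun e => F (e 0) (e 1)) ->
  Comp k f -> Comp k g -> Comp k (fun e => F (f e) (g e)).
Proof.
  intros HF Hf Hg. apply (Comp_subst 2 k _ (fun e => scons (f e) (scons (g e) e)) HF).
  intros [|[|i]] Hi; [exact Hf|exact Hg|lia].
Qed.

Lemma Comp_S k f : Comp k f -> Comp k (fun e => S (f e)).
Proof. apply (Comp_app1 S). exists PSucc. intro e. constructor. Qed.

Lemma Comp_const k c : Comp k (fun _ => c).
Proof. induction c as [|c IH]; [apply Comp_0|exact (Comp_S k (fun _ => c) IH)]. Qed.

Definition rec (a : nat) (b : nat -> nat -> nat) (n : nat) : nat :=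
  nat_rect (fun _ => nat) a b n.

Lemma map_env_seq (e : env) k :
  map e (seq 0 (S k)) = e 0 :: map (fun i => e (S i)) (seq 0 k).
Proof. simpl. now rewrite <- seq_shift, map_map. Qed.

Lemma Comp_rec k (a : env -> nat) (b : nat -> nat -> env -> nat) f :
  Comp k a -> Comp (S (S k)) (fun e => b (e 0) (e 1) (fun i => e (S (S i)))) -> Comp k f ->
  Comp k (fun e => rec (a e) (fun n r => b n r e) (f e)).
Proof.
  intros [p Hp] [q Hq] Hf.
  assert (H : Comp (S k) (fun e => rec (a (fun i => e (S i)))
                (fun n r => b n r (fun i => e (S i))) (e 0))).
  { exists (PRec p q). intro e. rewrite map_env_seq.
    set (e' := fun i => e (S i)). induction (e 0) as [|n IH]; simpl.
    - constructor. apply Hp.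
    - econstructor; [exact IH|].
      specialize (Hq (scons n (scons (rec (a e') (fun n r => b n r e') n) e'))).
      rewrite !map_env_seq in Hq. exact Hq. }
  apply (Comp_subst (S k) k _ (fun e => scons (f e) e) H).
  intros [|i] Hi; [exact Hf|]. apply Comp_var. lia.
Qed.

Create HintDb comp.
#[local] Hint Resolve Comp_S Comp_0 : comp.
#[local] Hint Extern 1 (Comp _ (fun e => e _)) => apply Comp_var; lia : comp.
#[local] Hint Extern 5 (Comp _ (fun _ => _)) => apply Comp_const : comp.

Ltac comp := cbv beta; auto 60 with comp nocore.

Lemma Comp_add k f g : Comp k f -> Comp k g -> Comp k (fun e => f e + g e).
Proof.
  apply (Comp_app2 Nat.add). apply (Comp_ext _ (fun e => rec (e 1) (fun _ r => S r) (e 0))).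
  - intro e. induction (e 0) as [|n IH]; simpl; [reflexivity|]. now rewrite IH.
  - apply (Comp_rec 2 (fun e => e 1) (fun _ r _ => S r)); comp.
Qed.
#[local] Hint Resolve Comp_add : comp.

Lemma Comp_pred k f : Comp k f -> Comp k (fun e => pred (f e)).
Proof.
  apply (Comp_app1 pred). apply (Comp_ext _ (fun e => rec 0 (fun n _ => n) (e 0))).
  - intro e. now destruct (e 0).
  - apply (Comp_rec 1 (fun _ => 0) (fun n _ _ => n)); comp.
Qed.
#[local] Hint Resolve Comp_pred : comp.

Lemma Comp_sub k f g : Comp k f -> Comp k g -> Comp k (fun e => f e - g e).
Proof.
  apply (Comp_app2 Nat.sub). apply (Comp_ext _ (fun e => rec (e 0) (fun _ r => pred r) (e 1))).
  - intro e. induction (e 1) as [|n IH]; simpl; [lia|]. rewrite IH. lia.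
  - apply (Comp_rec 2 (fun e => e 0) (fun _ r _ => pred r)); comp.
Qed.
#[local] Hint Resolve Comp_sub : comp.

Definition ifz (c a b : nat) : nat := match c with 0 => a | S _ => b end.

Lemma Comp_ifz k f g h : Comp k f -> Comp k g -> Comp k h ->
  Comp k (fun e => ifz (f e) (g e) (h e)).
Proof.
  intros Hf Hg Hh.
  apply (Comp_subst 3 k (fun e => ifz (e 0) (e 1) (e 2))
    (fun e => scons (f e) (scons (g e) (scons (h e) e)))).
  - apply (Comp_ext _ (fun e => rec (e 1) (fun _ _ => e 2) (e 0))).
    + intro e. now destruct (e 0).
    + apply (Comp_rec 3 (fun e => e 1) (fun _ _ e => e 2)); comp.
  - intros [|[|[|i]]] Hi; [exact Hf|exact Hg|exact Hh|lia].
Qed.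
#[local] Hint Resolve Comp_ifz : comp.

Definition tri (n : nat) : nat := rec 0 (fun m r => r + S m) n.

Lemma tri_spec n : 2 * tri n = n * S n.
Proof. unfold tri. induction n as [|n IH]; simpl in *; lia. Qed.

Lemma pair_tri x y : pair x y = tri (x + y) + y.
Proof. pose proof (pair_spec x y). pose proof (tri_spec (x + y)). lia. Qed.

Lemma Comp_tri k f : Comp k f -> Comp k (fun e => tri (f e)).
Proof.
  apply (Comp_app1 tri). unfold tri.
  apply (Comp_rec 1 (fun _ => 0) (fun m r _ => r + S m)); comp.
Qed.
#[local] Hint Resolve Comp_tri : comp.

Lemma Comp_pair k f g : Comp k f -> Comp k g -> Comp k (fun e => pair (f e) (g e)).
Proof.
  apply (Comp_app2 pair). apply (Comp_ext _ (fun e => tri (e 0 + e 1) + e 1)); [|comp].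
  intro e. now rewrite pair_tri.
Qed.
#[local] Hint Resolve Comp_pair : comp.

(** The largest [r] with [tri r <= z]; it grows by at most one when [z] does, so primitive recursion
    finds it. It decodes pairs without search. *)
Definition tri_root (z : nat) : nat :=
  rec 0 (fun m r => ifz (tri (S r) - S m) (S r) r) z.

Lemma tri_root_spec z : tri (tri_root z) <= z < tri (S (tri_root z)).
Proof.
  induction z as [|z IH]; [vm_compute; lia|].
  unfold tri_root in *. cbn [rec nat_rect]. fold (rec 0 (fun m r => ifz (tri (S r) - S m) (S r) r) z).
  set (r := rec _ _ z) in *. destruct (tri (S r) - S z) eqn:E; cbn [ifz].
  - pose proof (tri_spec (S r)). pose proof (tri_spec (S (S r))). lia.
  - lia.
Qed.

Lemma tri_root_pair x y : tri_root (pair x y) = x + y.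
Proof.
  pose proof (tri_root_spec (pair x y)) as H. rewrite (pair_tri x y) in H at 2 3.
  set (r := tri_root _) in *.
  pose proof (tri_spec r). pose proof (tri_spec (S r)).
  pose proof (tri_spec (x + y)). nia.
Qed.

Lemma pi2_tri z : pi2 z = z - tri (tri_root z).
Proof.
  rewrite <- (pair_pi z) at 2 3. rewrite tri_root_pair, pair_tri. lia.
Qed.

Lemma pi1_tri z : pi1 z = tri_root z - pi2 z.
Proof. rewrite <- (pair_pi z) at 2. rewrite tri_root_pair. lia. Qed.

Lemma Comp_tri_root k f : Comp k f -> Comp k (fun e => tri_root (f e)).
Proof.
  apply (Comp_app1 tri_root). unfold tri_root.
  apply (Comp_rec 1 (fun _ => 0) (fun m r _ => ifz (tri (S r) - S m) (S r) r)); comp.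
Qed.
#[local] Hint Resolve Comp_tri_root : comp.

Lemma Comp_pi2 k f : Comp k f -> Comp k (fun e => pi2 (f e)).
Proof.
  intro Hf. apply (Comp_ext _ (fun e => f e - tri (tri_root (f e)))); [|comp].
  intro e. symmetry. apply pi2_tri.
Qed.
#[local] Hint Resolve Comp_pi2 : comp.

Lemma Comp_pi1 k f : Comp k f -> Comp k (fun e => pi1 (f e)).
Proof.
  intro Hf. apply (Comp_ext _ (fun e => tri_root (f e) - pi2 (f e))); [|comp].
  intro e. symmetry. apply pi1_tri.
Qed.
#[local] Hint Resolve Comp_pi1 : comp.

Definition parity (n : nat) : nat := rec 0 (fun _ r => 1 - r) n.
Definition half (n : nat) : nat := rec 0 (fun m r => r + parity m) n.

Lemma half_parity_double c b : b < 2 -> half (2 * c + b) = c /\ parity (2 * c + b) = b.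
Proof.
  intro Hb.
  assert (H : forall c, half (2 * c) = c /\ parity (2 * c) = 0).
  { induction c0 as [|n [IH1 IH2]]; [now split|].
    replace (2 * S n) with (S (S (2 * n))) by lia.
    change (half (S (S (2 * n)))) with (half (2 * n) + parity (2 * n) + (1 - parity (2 * n))).
    change (parity (S (S (2 * n)))) with (1 - (1 - parity (2 * n))).
    rewrite IH1, IH2. lia. }
  destruct (H c) as [H1 H2]. destruct b as [|[|b]]; [|rewrite Nat.add_1_r|lia].
  - now rewrite Nat.add_0_r.
  - change (half (S (2 * c))) with (half (2 * c) + parity (2 * c)).
    change (parity (S (2 * c))) with (1 - parity (2 * c)). rewrite H1, H2. lia.
Qed.

Lemma Comp_parity k f : Comp k f -> Comp k (fun e => parity (f e)).
Proof.
  apply (Comp_app1 parity). unfold parity.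
  apply (Comp_rec 1 (fun _ => 0) (fun _ r _ => 1 - r)); comp.
Qed.
#[local] Hint Resolve Comp_parity : comp.

Lemma Comp_half k f : Comp k f -> Comp k (fun e => half (f e)).
Proof.
  apply (Comp_app1 half). unfold half.
  apply (Comp_rec 1 (fun _ => 0) (fun m r _ => r + parity m)); comp.
Qed.
#[local] Hint Resolve Comp_half : comp.

(** Beyond the end of the string the remaining code is 0 and stays 0, so the bit is read as 0
    there. *)
Definition bit (t i : nat) : nat := parity (pred (rec t (fun _ r => half (pred r)) i)).

Lemma bit_code_string s i : bit (code_string s) i = Nat.b2n (nth i s false).
Proof.
  assert (Hrec : forall i t, rec t (fun _ r => half (pred r)) (S i) =
                             rec (half (pred t)) (fun _ r => half (pred r)) i).
  { induction i0 as [|j IH]; intro t; [reflexivity|].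
    change (half (pred (rec t (fun _ r => half (pred r)) (S j))) =
            half (pred (rec (half (pred t)) (fun _ r => half (pred r)) j))).
    now rewrite IH. }
  assert (Hb : forall b, Nat.b2n b < 2) by (intros []; simpl; lia).
  unfold bit. revert i. induction s as [|b s IH]; intro i.
  - assert (H : forall i, rec 0 (fun _ r => half (pred r)) i = 0).
    { induction i0 as [|j IHj]; [reflexivity|]. now rewrite Hrec. }
    simpl code_string. rewrite H. now destruct i.
  - destruct (half_parity_double (code_string s) (Nat.b2n b) (Hb b)) as [H1 H2].
    destruct i as [|i].
    + exact H2.
    + rewrite Hrec. change (pred (code_string (b :: s))) with (2 * code_string s + Nat.b2n b).
      rewrite H1. apply IH.
Qed.

Lemma Comp_bit k f g : Comp k f -> Comp k g -> Comp k (fun e => bit (f e) (g e)).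
Proof.
  apply (Comp_app2 bit). unfold bit.
  apply Comp_parity, Comp_pred.
  apply (Comp_rec 2 (fun e => e 0) (fun _ r _ => half (pred r))); comp.
Qed.
#[local] Hint Resolve Comp_bit : comp.

(** * The witness for well-founded trees *)

(* [S y] for the last [y < t] such that the string coded by [t] contains
   [⟨s, 2y⟩], and [0] if there is none. *)
Definition find (t s : nat) : nat :=
  rec 0 (fun j r => ifz (bit t (pair s (j + j))) r (S j)) t.

(* State [S (S s)]: the node [s] has been reached; states [0] and [1] are the
   final answers. *)
Definition step (t q : nat) : nat :=
  ifz q 0 (ifz (pred q) 1 (ifz (find t (pred (pred q))) q (pred (find t (pred (pred q)))))).

(** The initial state 2 is the root, node 0. The code of a string is at least its length, so [t]
    steps suffice for long strings. *)
Definition run (t : nat) : nat := rec 2 (fun _ q => step t q) t.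

(** [z] is read as [⟨x, ⟨t, ⟨n, b⟩⟩⟩]: column, input string, output position and bit. The column is
    ignored, and no tree is mentioned: one recursive witness serves all instances. Bit 0 is output
    once the run has ended; all later bits are 0, as the disjuncts carry no information. *)
Definition follow (z : nat) : nat :=
  let t := pi1 (pi2 z) in
  let b := pi2 (pi2 (pi2 z)) in
  ifz (pi1 (pi2 (pi2 z)))
    (ifz (run t) (ifz b 0 (ifz (pred b) 1 0)) (ifz (pred (run t)) (ifz b 1 0) 0))
    (ifz b 1 0).

Lemma Comp_find k f g : Comp k f -> Comp k g -> Comp k (fun e => find (f e) (g e)).
Proof.
  apply (Comp_app2 find). unfold find.
  apply (Comp_rec 2 (fun _ => 0) (fun j r e => ifz (bit (e 0) (pair (e 1) (j + j))) r (S j))); comp.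
Qed.
#[local] Hint Resolve Comp_find : comp.

Lemma Comp_run k f : Comp k f -> Comp k (fun e => run (f e)).
Proof.
  apply (Comp_app1 run). unfold run.
  apply (Comp_rec 1 (fun _ => 2) (fun _ q e => step (e 0) q)); unfold step; comp.
Qed.
#[local] Hint Resolve Comp_run : comp.

Lemma Comp_recursive (f : nat -> nat) : Comp 1 (fun e => f (e 0)) -> recursive f.
Proof. intros [p Hp]. exists p. intro n. exact (Hp (fun _ => n)). Qed.

Lemma follow_recursive_set : recursive_set (fun z => follow z = 1).
Proof.
  exists follow. split.
  - apply Comp_recursive. unfold follow. cbv zeta. comp.
  - intro z. assert (H : follow z = 1 \/ follow z = 0).
    { unfold follow. cbv zeta.
      destruct (pi1 (pi2 (pi2 z))), (run (pi1 (pi2 z))) as [|[|]], (pi2 (pi2 (pi2 z))) as [|[|]];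
        simpl; auto. }
    destruct H as [H|H]; [left|right]; split; congruence.
Qed.

Lemma find_sound t s y : find t s = S y -> bit t (pair s (y + y)) <> 0.
Proof.
  unfold find. generalize t at 2. induction t0 as [|n IH]; cbn [rec nat_rect]; [discriminate|].
  destruct (bit t (pair s (n + n))) eqn:E; cbn [ifz].
  - exact IH.
  - intro H. injection H as <-. now rewrite E.
Qed.

Lemma find_complete t s y : y < t -> bit t (pair s (y + y)) <> 0 -> find t s <> 0.
Proof.
  intros Hy Hb. unfold find. generalize t at 2, Hy. clear Hy.
  intros t0 Hy. induction t0 as [|n IH]; [lia|]. cbn [rec nat_rect].
  destruct (bit t (pair s (n + n))) eqn:E; cbn [ifz]; [|discriminate].
  apply IH. destruct (Nat.eq_dec y n) as [->|]; [congruence|lia].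
Qed.

Lemma code_string_ge_length s : length s <= code_string s.
Proof. induction s as [|b s IH]; simpl; lia. Qed.

Definition path_step (f : nat -> nat) (q : nat) : nat :=
  match q with S (S s) => f s | _ => q end.

Definition path (f : nat -> nat) (k : nat) : nat := rec 2 (fun _ q => path_step f q) k.

Lemma bit_initial_segment F s i :
  initial_segment s F -> bit (code_string s) i <> 0 <-> i < length s /\ F i.
Proof.
  intro Hs. rewrite bit_code_string. destruct (Nat.lt_ge_cases i (length s)) as [L|L].
  - specialize (Hs i L). destruct (nth i s false); simpl; intuition congruence.
  - rewrite nth_overflow by exact L. simpl. intuition lia.
Qed.

(** With too short a string the run may stall, but it never moves to a wrong state. *)
Lemma step_path_step F f s q :
  (forall s m, F (pair s (m + m)) <-> m = f s) -> initial_segment s F ->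
  step (code_string s) q = q \/ step (code_string s) q = path_step f q.
Proof.
  intros HF Hs. destruct q as [|[|q]]; [now left|now left|]. cbn.
  destruct (find (code_string s) q) as [|y] eqn:E; [now left|right].
  apply find_sound in E. apply (bit_initial_segment F s _ Hs) in E as [_ E].
  now apply HF in E.
Qed.

Lemma step_eq_path_step F f s q :
  (forall s m, F (pair s (m + m)) <-> m = f s) -> initial_segment s F ->
  (forall r, q = S (S r) -> pair r (f r + f r) < length s) ->
  step (code_string s) q = path_step f q.
Proof.
  intros HF Hs Hq. destruct q as [|[|q]]; [reflexivity|reflexivity|]. cbn.
  specialize (Hq q eq_refl).
  destruct (find (code_string s) q) as [|y] eqn:E.
  - exfalso. revert E. apply (find_complete _ _ (f q)).
    + pose proof (pair_ge q (f q + f q)). pose proof (code_string_ge_length s). lia.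
    + apply (bit_initial_segment F s _ Hs). split; [exact Hq|]. now apply HF.
  - apply find_sound in E. apply (bit_initial_segment F s _ Hs) in E as [_ E].
    now apply HF in E.
Qed.

Lemma run_on_path F f s :
  (forall s m, F (pair s (m + m)) <-> m = f s) -> initial_segment s F -> exists k, run (code_string s) = path f k.
Proof.
  intros HF Hs. unfold run. generalize (code_string s) at 2.
  induction n as [|n [k IH]]; [now exists 0|]. cbn [rec nat_rect].
  change (nat_rect _ _ _ n) with (rec 2 (fun _ q => step (code_string s) q) n). rewrite IH.
  destruct (step_path_step F f s (path f k) HF Hs) as [->| ->]; [now exists k|now exists (S k)].
Qed.

Lemma initial_segment_exists F N : exists s, length s = N /\ initial_segment s F.
Proof.
  exists (map (fun i => if excluded_middle_informative (F i) then true else false) (seq 0 N)).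
  split; [now rewrite length_map, length_seq|]. intros i Hi.
  rewrite length_map, length_seq in Hi.
  rewrite nth_indep with (d' := if excluded_middle_informative (F 0) then true else false)
    by now rewrite length_map, length_seq.
  rewrite map_nth with (f := fun i => if excluded_middle_informative (F i) then true else false),
    seq_nth by exact Hi.
  simpl. destruct (excluded_middle_informative (F i)); split; easy.
Qed.

(** On a long enough string the run never stalls before the path ends, and from then on the path is
    constant. *)
Lemma run_reaches F f k :
  (forall s m, F (pair s (m + m)) <-> m = f s) -> path f k < 2 ->
  exists s, initial_segment s F /\ run (code_string s) = path f k.
Proof.
  intros HF Hk.
  (* [N] exceeds all positions consulted before stage [k]; being at least [k], it also guarantees
     enough steps. *)
  assert (HN : exists N, k <= N /\
    forall i r, i < k -> path f i = S (S r) -> pair r (f r + f r) < N).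
  { clear Hk. induction k as [|k (N & HkN & HN)]; [exists 0; split; lia|].
    set (r0 := pred (pred (path f k))).
    exists (N + S k + S (pair r0 (f r0 + f r0))). split; [lia|]. intros i r Hi Hr.
    destruct (Nat.eq_dec i k) as [->|].
    - replace r with r0 by (unfold r0; now rewrite Hr). lia.
    - specialize (HN i r ltac:(lia) Hr). lia. }
  destruct HN as (N & HkN & HN).
  assert (Hconst : forall j, path f (k + j) = path f k).
  { induction j as [|j IH]; [now rewrite Nat.add_0_r|].
    rewrite Nat.add_succ_r. change (path_step f (path f (k + j)) = path f k). rewrite IH.
    destruct (path f k) as [|[|]]; [reflexivity|reflexivity|lia]. }
  destruct (initial_segment_exists F N) as (s & Hl & Hs). exists s. split; [exact Hs|].
  assert (H : forall n, rec 2 (fun _ q => step (code_string s) q) n = path f n).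
  { induction n as [|n IH]; [reflexivity|].
    change (step (code_string s) (rec 2 (fun _ q => step (code_string s) q) n) =
            path_step f (path f n)).
    rewrite IH. apply (step_eq_path_step F); [exact HF|exact Hs|]. intros r Hr. rewrite Hl.
    destruct (Nat.lt_ge_cases n k) as [L|L]; [now apply (HN n)|].
    replace n with (k + (n - k)) in Hr by lia. rewrite Hconst in Hr. lia. }
  unfold run. rewrite H. pose proof (code_string_ge_length s).
  replace (code_string s) with (k + (code_string s - k)) by lia. apply Hconst.
Qed.

(** The path starts at node 0; this is why configurations are required to allow it. *)
Lemma valid_0 T x : valid T x 0.
Proof. intros a [(_ & _ & _ & H & _) _]. exact H. Qed.

(** The path visits valid nodes only, since an answer at a valid node is a valid child or the truth
    about the secret. Without an infinite chain it must therefore end with the secret. *)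
Lemma follow_decides T x F : ~ infinite_chain T -> answers T x F ->
  exists Y, applies (column (fun z => follow z = 1) x) F Y /\ (Y 0 <-> secret T x).
Proof.
  intros HT HF. destruct (choice _ HF) as [f Hf].
  assert (HFf : forall s m, F (pair s (m + m)) <-> m = f s).
  { intros s m. replace (m + m) with (2 * m) by lia. apply Hf. }
  assert (Hinv : forall k, match path f k with
    | 0 => secret T x | 1 => ~ secret T x | S (S s) => valid T x s end).
  { induction k as [|k IH]; [apply valid_0|].
    change (path f (S k)) with (path_step f (path f k)).
    destruct (path f k) as [|[|s]]; [exact IH|exact IH|]. cbn [path_step].
    destruct (proj2 (Hf s) IH) as [(s' & -> & _ & Hs')|[_ [[-> H]|[-> H]]]]; assumption. }
  assert (Hend : exists k, path f k < 2).
  { apply NNPP. intro Hno. apply HT. exists (fun k => pred (pred (path f k))).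
    split; [reflexivity|]. intro k.
    assert (Hk : exists s, path f k = S (S s)).
    { destruct (path f k) as [|[|s]] eqn:E; [exfalso; apply Hno; exists k; lia..|eauto]. }
    destruct Hk as [s Hk]. specialize (Hinv k). rewrite Hk in Hinv.
    assert (HSk : path f (S k) = f s)
      by (change (path_step f (path f k) = f s); now rewrite Hk).
    rewrite Hk, HSk. change (pred (pred (S (S s)))) with s.
    destruct (proj2 (Hf s) Hinv) as [(s' & -> & H & _)|[_ H]]; [exact H|].
    exfalso. apply Hno. exists (S k). rewrite HSk. destruct H as [[-> _]|[-> _]]; lia. }
  destruct Hend as [k Hk].
  assert (Hout0 : forall b, outputs (column (fun z => follow z = 1) x) F 0 b <->
    (b = true <-> secret T x)).
  { intro b. unfold outputs, column, follow. split.
    - intros (s & Hs & H). rewrite !pi2_pair, !pi1_pair in H. cbn [ifz] in H.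
      destruct (run_on_path F f s HFf Hs) as [j Hj]. rewrite Hj in H.
      specialize (Hinv j).
      destruct (path f j) as [|[|q]], b; cbn in H; try discriminate; intuition congruence.
    - intro Hb. destruct (run_reaches F f k HFf Hk) as (s & Hs & Hr).
      exists s. split; [exact Hs|]. rewrite !pi2_pair, !pi1_pair. cbn [ifz].
      rewrite Hr. specialize (Hinv k).
      destruct (path f k) as [|[|q]], b; [..|lia|lia]; cbn; intuition congruence. }
  assert (HoutS : forall n b, outputs (column (fun z => follow z = 1) x) F (S n) b <-> b = false).
  { intros n b. unfold outputs, column, follow. split.
    - intros (s & Hs & H). rewrite !pi2_pair, !pi1_pair in H. cbn [ifz] in H.
      now destruct b.
    - intros ->. exists []. split; [intros i Hi; inversion Hi|].
      now rewrite !pi2_pair, !pi1_pair. }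
  exists (fun n => n = 0 /\ secret T x). split; [|tauto].
  intros [|n]; rewrite ?Hout0, ?HoutS; intuition congruence.
Qed.

(** * The reducing sentences *)

Lemma code_term_inj t u : code_term t = code_term u -> t = u.
Proof.
  revert u. induction t; intros []; simpl; intro H; invert_codes;
    try discriminate; subst; f_equal; auto.
Qed.

Lemma code_formula_inj A B : code_formula A = code_formula B -> A = B.
Proof.
  revert B. induction A as [[]|A IH|A IHA C IHC|A IHA C IHC|A IHA C IHC|A IH|A IH];
    intros [[]| | | | | | ]; simpl; intro H; invert_codes; try discriminate;
    repeat f_equal; auto using code_term_inj.
Qed.

Fixpoint num (n : nat) : term :=
  match n with 0 => Zero | S n => Add (num n) One end.

Lemma eval_num e n : eval_term e (num n) = n.
Proof. induction n as [|n IH]; simpl; [reflexivity|]. rewrite IH. lia. Qed.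

Lemma num_bounded k n : term_bounded k (num n).
Proof. induction n; simpl; auto. Qed.

(* [~ A(n)], which carries no information. *)
Definition refute (n : nat) (A : formula arith_atom) : formula arith_atom :=
  Neg (Ex (And (Atom (Eq (Var 0) (num n))) A)).

Lemma witness_refute e n A W : witness e (refute n A) W <-> ~ sata (scons n e) A.
Proof.
  unfold refute. rewrite witness_Neg_iff. simpl. split; intros H HA; apply H.
  - exists n. split; [now rewrite eval_num|exact HA].
  - destruct HA as (m & E & HA). rewrite eval_num in E. now subst m.
Qed.

(** As [refute] negates, [A], [B] and [C] will define the complements of [answer], of [secret] and
    of its negation. The parameter enters only through numerals, which keeps the Gödel number easy
    to compute. *)
Definition reduction (A B C : formula arith_atom) (n : nat) : formula arith_atom :=
  All (Imp (All (Ex (refute n A))) (Or (refute n B) (refute n C))).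

Lemma reduction_recursive A B C : recursive (fun n => code_formula (reduction A B C n)).
Proof.
  assert (Hnum : forall k f, Comp k f -> Comp k (fun e => code_term (num (f e)))).
  { intros k f. apply (Comp_app1 (fun n => code_term (num n))).
    apply (Comp_ext _ (fun e => rec (pair 1 0) (fun _ r => pair 3 (pair r (pair 2 0))) (e 0))).
    - intro e. induction (e 0) as [|n IH]; [reflexivity|]. simpl in *. now rewrite <- IH.
    - apply (Comp_rec 1 (fun _ => pair 1 0) (fun _ r _ => pair 3 (pair r (pair 2 0)))); comp. }
  apply Comp_recursive. unfold reduction, refute. cbn [code_formula code_term]. comp.
Qed.

(** [Def] gives no bound on the free variables of its formula. The predicates concerned depend on
    the first [k] entries only, so replacing the other variables by [Zero] closes the formula
    without changing its meaning. *)
Definition below (k i : nat) : option nat := if i <? k then Some i else None.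

Lemma below_bounded k A : bounded arith_atom_bounded k (map_vars (below k) A).
Proof.
  apply map_vars_bounded. intros i j. unfold below.
  destruct (Nat.ltb_spec i k); intro E; now inversion E; subst.
Qed.

Lemma reduction_sentence A B C n :
  sentence (reduction (map_vars (below 4) A) (map_vars (below 2) B) (map_vars (below 2) C) n).
Proof.
  unfold sentence, reduction, refute. cbn.
  repeat split; auto using num_bounded, below_bounded with arith.
Qed.

Theorem theorem1 (P : nat -> Prop) (hP : Pi11 P) :
  many_one_reducible P constructive_truth_set.
Proof.
  destruct (Pi11_no_infinite_chain P hP) as (T & HT & HP).
  destruct (Def_secret_answer T HT) as [Hsec Hans].
  (* Inside the sentence, index 0 is the parameter bound by [refute], followed by [y], [s] and [x],
     from the innermost quantifier outwards. *)
  assert (HA : Def (fun e => ~ answer (T (e 0)) (e 3) (e 2) (e 1))).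
  { apply Def_not. refine (Def_subst _ (fun e => scons (e 0) (scons (e 3)
      (scons (e 2) (scons (e 1) e)))) Hans _).
    repeat apply DefF_scons; intros; apply DefF_var. }
  destruct HA as [A HA]. destruct (Def_not _ Hsec) as [B HB]. destruct Hsec as [C HC].
  set (red := reduction (map_vars (below 4) A) (map_vars (below 2) B) (map_vars (below 2) C)).
  exists (fun n => code_formula (red n)). split; [apply reduction_recursive|].
  (* With the negated parts evaluated classically, a witness is exactly a continuous decision of
     [secret] from answer functions, uniform in [x]. *)
  assert (Hw : forall n W, witness env0 (red n) W <->
    forall x F, answers (T n) x F ->
      exists Y, applies (column W x) F Y /\ (Y 0 <-> secret (T n) x)).
  { intros n W. unfold red, reduction. cbn [witness].
    assert (H1 : forall x F, (forall s, exists y,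
        (forall m, even_part (column F s) m <-> m = y) /\
        witness (scons y (scons s (scons x env0))) (refute n (map_vars (below 4) A))
          (odd_part (column F s))) <-> answers (T n) x F).
    { intros x F. split; intros H s; destruct (H s) as (y & Hy & Ha); exists y;
        (split; [exact Hy|]).
      - apply witness_refute in Ha. rewrite sat_map_vars, HA in Ha. now apply NNPP.
      - apply witness_refute. rewrite sat_map_vars, HA. intro Hn. now apply Hn. }
    assert (H2 : forall x Y,
        (Y 0 /\ witness (scons x env0) (refute n (map_vars (below 2) B)) (tail Y) \/
         ~ Y 0 /\ witness (scons x env0) (refute n (map_vars (below 2) C)) (tail Y)) <->
        (Y 0 <-> secret (T n) x)).
    { intros x Y. rewrite !witness_refute, !sat_map_vars, HB, HC.
      change (map_env _ _ 0) with n. change (map_env _ _ 1) with x. tauto. }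
    split; intros H x F HF.
    - destruct (H x F (proj2 (H1 x F) HF)) as (Y & HY & HY').
      exists Y. split; [exact HY|]. now apply H2.
    - destruct (H x F (proj1 (H1 x F) HF)) as (Y & HY & HY').
      exists Y. split; [exact HY|]. now apply H2. }
  intro n. rewrite HP. split.
  - intro Hn. exists (red n). split; [reflexivity|]. split; [apply reduction_sentence|].
    exists (fun z => follow z = 1). split; [apply follow_recursive_set|].
    apply Hw. intros x F. now apply follow_decides.
  - intros (D & HD & _ & W & HWrec & HW) Hn. apply code_formula_inj in HD. subst D.
    apply (infinite_chain_not_decided (T n) W Hn HWrec). now apply Hw.
Qed.
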